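(* (1) For each ccdg-Hopf algebra $\Omega$ there is a presheaf of Lie algebras $T\mathfrak{P}_\Omega:(ho\,\mathbf{ccdgC}(\Bbbk))^{op}\to\mathbf{Lie}(\Bbbk)$ on the homotopy category of ccdg-coalgebras, sending - each ccdg-coalgebra $C$ to the Lie algebra $T\mathfrak{P}_\Omega(C)$ with underlying set $\mathrm{THom}_{ho\,\mathbf{ccdgC}(\Bbbk)}(C,\Omega)$ and Lie bracket $[[\upsilon_1],[\upsilon_2]]:=[m_\Omega\circ(\upsilon_1\otimes\upsilon_2-\upsilon_2\otimes\upsilon_1)\circ\Delta_C]$, where $\upsilon_1,\upsilon_2\in\mathrm{THom}_{\mathbf{ccdgC}(\Bbbk)}(C,\Omega)$ are arbitrary representatives of the homotopy types $[\upsilon_1],[\upsilon_2]$; - each morphism $[f]\in\mathrm{Hom}_{ho\,\mathbf{ccdgC}(\Bbbk)}(C,C')$ to the Lie algebra morphism $T\mathfrak{P}_\Omega([f]):T\mathfrak{P}_\Omega(C')\to T\mathfrak{P}_\Omega(C)$, $T\mathfrak{P}_\Omega([f])([\upsilon']):=[\upsilon'\circ f]$, where $f$ and $\upsilon'$ are arbitrary representatives of $[f]$ and $[\upsilon']$; and $T\mathfrak{P}_\Omega([f])$ is an isomorphism of Lie algebras whenever $f:C\to C'$ is a homotopy equivalence of ccdg-coalgebras. (2) For every morphism $[\psi]\in\mathrm{Hom}_{ho\,\mathbf{ccdgH}(\Bbbk)}(\Omega,\Omega')$ there is a natural transformation $T\mathscr{N}_{[\psi]}:T\mathfrak{P}_\Omega\Rightarrow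 T\mathfrak{P}_{\Omega'}$ of functors $(ho\,\mathbf{ccdgC}(\Bbbk))^{op}\to\mathbf{Lie}(\Bbbk)$ whose component at each ccdg-coalgebra $C$ is $T\mathscr{N}^C_{[\psi]}([\upsilon]):=[\psi\circ\upsilon]$ for all $[\upsilon]\in\mathrm{THom}_{ho\,\mathbf{ccdgC}(\Bbbk)}(C,\Omega)$, where $\psi$ and $\upsilon$ are arbitrary representatives of $[\psi]$ and $[\upsilon]$; and $T\mathscr{N}_{[\psi]}$ is a natural isomorphism whenever $\psi:\Omega\to\Omega'$ is a homotopy equivalence of ccdg-Hopf algebras.
   Context: $\Bbbk$ is a field of characteristic zero. All graded objects are $\mathbb{Z}$-graded with homological grading (differentials have degree $-1$), $\otimes=\otimes_\Bbbk$, and the Koszul sign rule is used. For chain complexes $V,W$, $\mathrm{Hom}(V,W)_n$ is the space of $\Bbbk$-linear maps raising degree by $n$, $\mathrm{Hom}(V,W)=\bigoplus_n\mathrm{Hom}(V,W)_n$, with differential $\partial_{V,W}f=\partial_W\circ f-(-1)^{|f|}f\circ\partial_V$. $\mathbb{I}$ denotes identity maps. A ccdg-coalgebra $C=(C,\epsilon_C,\Delta_C,\partial_C)$ is a counital coassociative graded-cocommutative dg-coalgebra over $\Bbbk$ ($\epsilon_C,\Delta_C$ are chain maps). Morphisms are degree $0$ chain maps compatible with counits and coproducts; the category is $\mathbf{ccdgC}(\Bbbk)$. A ccdg-Hopf algebra $\Omega=(\Omega,u_\Omega,m_\Omega,\epsilon_\Omega,\Delta_\Omega,\varsigma_\Omega,\partial_\Omega)$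 is simultaneously a unital associative (not necessarily commutative) dg-algebra and a ccdg-coalgebra such that $\epsilon_\Omega$ and $\Delta_\Omega$ are dg-algebra morphisms, with an antipode, i.e. a degree $0$ linear map $\varsigma_\Omega$ with $m_\Omega\circ(\varsigma_\Omega\otimes\mathbb{I}_\Omega)\circ\Delta_\Omega=m_\Omega\circ(\mathbb{I}_\Omega\otimes\varsigma_\Omega)\circ\Delta_\Omega=u_\Omega\circ\epsilon_\Omega$. Morphisms are maps that are both dg-algebra and ccdg-coalgebra morphisms; the category is $\mathbf{ccdgH}(\Bbbk)$. A homotopy pair on $\mathrm{Hom}_{\mathbf{ccdgC}(\Bbbk)}(C,C')$ is a pair $(f(t),\xi(t))\in\mathrm{Hom}(C,C')_0[t]\oplus\mathrm{Hom}(C,C')_1[t]$ (polynomial in $t$) with $\frac{d}{dt}f(t)=\partial_{C,C'}\xi(t)$, $f(0)\in\mathrm{Hom}_{\mathbf{ccdgC}(\Bbbk)}(C,C')$, $\epsilon_{C'}\circ\xi(t)=0$ and $\Delta_{C'}\circ\xi(t)=(f(t)\otimes\xi(t)+\xi(t)\otimes f(t))\circ\Delta_C$. A homotopy pair on $\mathrm{Hom}_{\mathbf{ccdgH}(\Bbbk)}(\Omega,\Omega')$ is defined by the same conditions together with: $f(0)$ is a dg-algebra morphism, $\xi(t)\circ u_\Omega=0$ and $\xi(t)\circ m_\Omega=m_{\Omega'}\circ(f(t)\otimes\xi(t)+\xi(t)\otimes f(t))$. Two morphisms are homotopic, $f\sim\tilde f$, if there is a homotopy pair with $f(0)=f$,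 $f(1)=\tilde f$; the homotopy type $[f]$ is the class of $f$ under the equivalence relation (generated by) $\sim$. The homotopy categories $ho\,\mathbf{ccdgC}(\Bbbk)$ and $ho\,\mathbf{ccdgH}(\Bbbk)$ have the same objects and homotopy types of morphisms as morphisms, with $[f']\circ[f]=[f'\circ f]$. A homotopy equivalence is a morphism $f$ with a morphism $h$ in the opposite direction such that $h\circ f\sim\mathbb{I}$ and $f\circ h\sim\mathbb{I}$. Put $e_{C,\Omega}:=u_\Omega\circ\epsilon_C$. Tangential morphisms: $\mathrm{THom}_{\mathbf{ccdgC}(\Bbbk)}(C,\Omega)$ is the set of $\upsilon\in\mathrm{Hom}(C,\Omega)_0$ with $\partial_{C,\Omega}\upsilon=0$, $\epsilon_\Omega\circ\upsilon=0$ and $\Delta_\Omega\circ\upsilon=(e_{C,\Omega}\otimes\upsilon+\upsilon\otimes e_{C,\Omega})\circ\Delta_C$. A homotopy pair on it is a pair $(\upsilon(t),\sigma(t))\in\mathrm{Hom}(C,\Omega)_0[t]\oplus\mathrm{Hom}(C,\Omega)_1[t]$ with $\frac{d}{dt}\upsilon(t)=\partial_{C,\Omega}\sigma(t)$, $\upsilon(0)\in\mathrm{THom}_{\mathbf{ccdgC}(\Bbbk)}(C,\Omega)$, $\epsilon_\Omega\circ\sigma(t)=0$ and $\Delta_\Omega\circ\sigma(t)=(e_{C,\Omega}\otimes\sigma(t)+\sigma(t)\otimes e_{C,\Omega})\circ\Delta_C$; $\upsilon\sim\tilde\upsilon$ (same homotopy type) if there is such a pair with $\upsilon(0)=\upsilon$,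 $\upsilon(1)=\tilde\upsilon$. $\mathrm{THom}_{ho\,\mathbf{ccdgC}(\Bbbk)}(C,\Omega)$ is the set of homotopy types $[\upsilon]$. $\mathbf{Lie}(\Bbbk)$ is the category of Lie algebras over $\Bbbk$. *)

(* Defs.v *)
From HB Require Import structures.
From mathcomp Require Import all_boot all_order all_algebra.
From mathcomp Require Import boolp classical_sets fsbigop.
From mathcomp Require Import freeg.
From Stdlib Require Relation_Operators.

Set Implicit Arguments.
Unset Strict Implicit.
Unset Printing Implicit Defensive.
Import GRing.Theory.
Local Open Scope ring_scope.

Lemma linear_ext (R : nzRingType) (U V : lmodType R) (f g : {linear U -> V}) :
  f =1 g -> f = g.
Proof.
case: f g => f cf [g cg] /= /funext fg; case: _ / fg in cg *.
by congr GRing.Linear.Pack; case: cf cg => [[a] [b]] [[c] [d]];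
   rewrite (Prop_irrelevance a c) (Prop_irrelevance b d).
Qed.

(* Locked, so that simplification does not unfold the maps built this way. *)
Fact to_linear_key : unit. Proof. by []. Qed.

Section LinearBuild.
Variables (R : nzRingType) (U V : lmodType R) (f : U -> V).
Hypothesis f_linear : linear f.

Definition linear_fun of linear f := f.
HB.instance Definition _ :=
  GRing.isLinear.Build R U V *:%R (linear_fun f_linear) f_linear.
Definition to_linear : {linear U -> V} :=
  locked_with to_linear_key (linear_fun f_linear : {linear U -> V}).
Lemma to_linearE x : to_linear x = f x.
Proof. by rewrite /to_linear unlock. Qed.
End LinearBuild.

Section FreegLift.
Variables (k : fieldType) (K : choiceType) (U : lmodType k) (f : K -> U).

HB.instance Definition _ := GRing.isZmodMorphism.Build
  {freeg K / k} U (fglift f) (lift_is_additive f).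

Fact fglift_linear : linear (fglift f).
Proof.
move=> a x y; rewrite raddfD; congr (_ + _).
rewrite [a *: x]/GRing.scale/= /fgscale -[in RHS](freeg_sumE x) !raddf_sum.
by apply: eq_bigr => i _; rewrite /= !liftU scalerA.
Qed.
End FreegLift.

Section TensorModule.
Variables (k : fieldType) (V W : lmodType k).
Notation free := {freeg (V * W)%type / k}.

Inductive tensor_relation : free -> Prop :=
| TensorRel0 : tensor_relation 0
| TensorRelD a x y :
    tensor_relation x -> tensor_relation y -> tensor_relation (a *: x + y)
| TensorRelL a v v' w : tensor_relation
    (<< (a *: v + v', w) >> - (a *: << (v, w) >> + << (v', w) >>))
| TensorRelR a v w w' : tensor_relation
    (<< (v, a *: w + w') >> - (a *: << (v, w) >> + << (v, w') >>)).

Definition tensor_ideal : {pred free} := fun x => `[< tensor_relation x >].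

Fact tensor_ideal_zmod : zmod_closed tensor_ideal.
Proof.
split; first by apply/asboolP; constructor.
move=> x y /asboolP rx /asboolP ry; apply/asboolP.
by rewrite -[- y]scaleN1r addrC; constructor.
Qed.
HB.instance Definition _ :=
  GRing.isZmodClosed.Build _ tensor_ideal tensor_ideal_zmod.

Definition tensor : Type := Quotient.quot tensor_ideal.
HB.instance Definition _ := GRing.Zmodule.on tensor.
HB.instance Definition _ := Quotient.on tensor.

Notation proj := (\pi_(Quotient.quot tensor_ideal)%qT : free -> tensor).

Fact projB (x y : free) : proj (x - y) = proj x - proj y.
Proof. exact: (raddfB \pi_(Quotient.quot tensor_ideal)%qT). Qed.
Fact projD (x y : free) : proj (x + y) = proj x + proj y.
Proof. exact: (raddfD \pi_(Quotient.quot tensor_ideal)%qT). Qed.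

Fact proj_eq (x y : free) :
  (proj x = proj y) <-> tensor_relation (x - y).
Proof.
split=> [/eqP|r]; first by rewrite -Quotient.idealrBE => /asboolP.
by apply/eqP; rewrite -Quotient.idealrBE; apply/asboolP.
Qed.

Definition tensor_scale (a : k) (x : tensor) : tensor :=
  proj (a *: repr (x : Quotient.quot tensor_ideal)).

Fact projZ (a : k) (x : free) : tensor_scale a (proj x) = proj (a *: x).
Proof.
rewrite /tensor_scale; apply/proj_eq; rewrite -scalerBr -[_ *: _]addr0.
constructor; last by constructor.
by apply/proj_eq; rewrite reprK.
Qed.

Fact proj_surj (t : tensor) : exists x : free, t = proj x.
Proof. by exists (repr (t : Quotient.quot tensor_ideal)); rewrite reprK. Qed.

Fact tensor_scaleA a b t :
  tensor_scale a (tensor_scale b t) = tensor_scale (a * b) t.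
Proof. by have [x ->] := proj_surj t; rewrite !projZ scalerA. Qed.
Fact tensor_scale1 t : tensor_scale 1 t = t.
Proof. by have [x ->] := proj_surj t; rewrite !projZ scale1r. Qed.
Fact tensor_scaleDr a : {morph tensor_scale a : x y / x + y}.
Proof.
move=> s t; have [x ->] := proj_surj s; have [y ->] := proj_surj t.
by rewrite -projD !projZ -projD scalerDr.
Qed.
Fact tensor_scaleDl t : {morph tensor_scale ^~ t : a b / a + b}.
Proof.
by move=> a b; have [x ->] := proj_surj t; rewrite !projZ -projD scalerDl.
Qed.
HB.instance Definition _ := GRing.Zmodule_isLmodule.Build k tensor
  tensor_scaleA tensor_scale1 tensor_scaleDr tensor_scaleDl.

Fact tensor_scaleE (a : k) (x : free) : a *: proj x = proj (a *: x).
Proof. exact: projZ. Qed.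

Definition tpure (v : V) (w : W) : tensor := proj << (v, w) >>.
Definition tpurel (w : W) (v : V) : tensor := tpure v w.

Fact tpure_linear v : linear (tpure v).
Proof.
by move=> a w w'; rewrite /tpure tensor_scaleE -projD; apply/proj_eq/TensorRelR.
Qed.
HB.instance Definition _ v :=
  GRing.isLinear.Build k W tensor *:%R (tpure v) (tpure_linear v).
Fact tpurel_linear w : linear (tpurel w).
Proof.
by move=> a v v'; rewrite /tpurel /tpure tensor_scaleE -projD; apply/proj_eq/TensorRelL.
Qed.
HB.instance Definition _ w :=
  GRing.isLinear.Build k V tensor *:%R (tpurel w) (tpurel_linear w).

Lemma tensor_ind (P : tensor -> Prop) :
  P 0 -> (forall a x y, P x -> P y -> P (a *: x + y)) ->
  (forall v w, P (tpure v w)) -> forall t, P t.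
Proof.
move=> P0 PD Pp t; have [x ->] := proj_surj t.
rewrite -[x]freeg_sumE; elim: (dom x) => [|[v w] s IHs].
  by rewrite big_nil -[X in proj X](subrr x) projB subrr.
rewrite big_cons projD.
have -> : << coeff (v, w) x *g (v, w) >> = coeff (v, w) x *: << (v, w) >> :> free.
  by apply/eqP/freeg_eqP => z; rewrite coeffZ !coeffU mul1r.
by rewrite -projZ; apply: (PD (coeff (v, w) x) (tpure v w)) => //; apply: IHs.
Qed.

Lemma tensor_ext (U : lmodType k) (f g : {linear tensor -> U}) :
  (forall v w, f (tpure v w) = g (tpure v w)) -> f =1 g.
Proof.
move=> fg; apply: tensor_ind => [|a x y fx fy|//]; first by rewrite !linear0.
by rewrite !linearP fx fy.
Qed.

Section Lift.
Variables (U : lmodType k) (f : V -> W -> U).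
Hypothesis f_linearl : forall w, linear (f^~ w).
Hypothesis f_linearr : forall v, linear (f v).

Let flift : {linear free -> U} :=
  to_linear (fglift_linear (fun vw : V * W => f vw.1 vw.2)).

Fact fliftU v w : flift << (v, w) >> = f v w.
Proof. by rewrite to_linearE liftU scale1r. Qed.

Fact flift_relation x : tensor_relation x -> flift x = 0.
Proof.
elim=> [|a {}x y _ IHx _ IHy|a v v' w|a v w w']; first exact: linear0.
- by rewrite linearP IHx IHy scaler0 addr0.
- by rewrite linearB linearP !fliftU f_linearl subrr.
- by rewrite linearB linearP !fliftU f_linearr subrr.
Qed.

Definition tlift_fun (t : tensor) : U :=
  flift (repr (t : Quotient.quot tensor_ideal)).

Fact tlift_proj x : tlift_fun (proj x) = flift x.
Proof.
apply/eqP; rewrite -subr_eq0 -linearB; apply/eqP/flift_relation/proj_eq.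
by rewrite reprK.
Qed.

Fact tlift_linear : linear tlift_fun.
Proof.
move=> a s t; have [x ->] := proj_surj s; have [y ->] := proj_surj t.
by rewrite tensor_scaleE -projD !tlift_proj linearP.
Qed.
Definition tlift : {linear tensor -> U} := to_linear tlift_linear.

Lemma tliftE v w : tlift (tpure v w) = f v w.
Proof. by rewrite to_linearE [LHS]tlift_proj fliftU. Qed.
End Lift.
End TensorModule.

(* Internal grading: [gr_proj n] is the projection onto the component of degree
   [n], and every element is the (finite) sum of its components. *)
Record graded (k : fieldType) := Graded {
  gr_mod :> lmodType k;
  gr_proj : int -> {linear gr_mod -> gr_mod};
  gr_projK : forall i j x,
    gr_proj i (gr_proj j x) = if i == j then gr_proj j x else 0;
  gr_sum : forall x, exists2 s : seq int, uniq s & x = \sum_(i <- s) gr_proj i x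
}.

Definition homog (k : fieldType) (V : graded k) (n : int) (x : V) : Prop :=
  gr_proj V n x = x.

Section GradedTheory.
Variables (k : fieldType) (V : graded k).

Definition window (s : seq int) (x : V) : Prop :=
  uniq s /\ forall i, i \notin s -> gr_proj V i x = 0.

Lemma windowP x : exists s, window s x.
Proof.
have [s us xE] := gr_sum x; exists s; split=> // i i_s.
rewrite xE linear_sum big_seq big1 // => j j_s; rewrite gr_projK.
by case: eqP => // ij; rewrite ij j_s in i_s.
Qed.

Lemma window2P x y : exists s, window s x /\ window s y.
Proof.
have [[s [_ sx]] [t [_ ty]]] := (windowP x, windowP y).
exists (undup (s ++ t)); split; (split; first exact: undup_uniq) => i;
  rewrite mem_undup mem_cat negb_or => /andP[i_s i_t]; [exact: sx|exact: ty].
Qed.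

Lemma windowD s a x y : window s x -> window s y -> window s (a *: x + y).
Proof.
by move=> [us sx] [_ sy]; split=> // i i_s; rewrite linearP sx ?sy ?scaler0 ?addr0.
Qed.

Lemma homog_proj n x : homog n (gr_proj V n x).
Proof. by rewrite /homog gr_projK eqxx. Qed.

Lemma homog_projE n i x : homog n x -> gr_proj V i x = if i == n then x else 0.
Proof. by move=> <-; rewrite gr_projK. Qed.

Section Gsum.
Variables (U : lmodType k) (F : int -> {linear V -> U}).

Definition gsum_fun (x : V) : U := \sum_(i \in [set: int]) F i (gr_proj V i x).

Lemma gsum_window s x : window s x ->
  gsum_fun x = \sum_(i <- s) F i (gr_proj V i x).
Proof.
move=> [us sx]; rewrite /gsum_fun (fsbigE s) //.
- by apply: eq_bigl => i; rewrite in_setT.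
- by move=> i _ i_s; rewrite sx // linear0.
Qed.

Fact gsum_linear : linear gsum_fun.
Proof.
move=> a x y; have [s [sx sy]] := window2P x y.
rewrite (gsum_window (windowD a sx sy)) (gsum_window sx) (gsum_window sy).
by rewrite scaler_sumr -big_split; apply: eq_bigr => i _; rewrite !linearP.
Qed.
Definition gsum : {linear V -> U} := to_linear gsum_linear.

Lemma gsumE s x : window s x -> gsum x = \sum_(i <- s) F i (gr_proj V i x).
Proof. by move=> sx; rewrite to_linearE (gsum_window sx). Qed.

Lemma gsum_homog n x : homog n x -> gsum x = F n x.
Proof.
move=> xn; have wx : window [:: n] x.
  by split=> // i; rewrite inE => /negPf i_n; rewrite (homog_projE _ xn) i_n.
by rewrite (gsumE wx) big_seq1 xn.
Qed.
End Gsum.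

Lemma gsum_idfun x : gsum (fun=> idfun) x = x.
Proof.
have [s us xE] := gr_sum x; rewrite (@gsumE _ _ s) //.
split=> // i i_s.
rewrite xE linear_sum big_seq big1 // => j j_s; rewrite gr_projK.
by case: eqP => // ij; rewrite ij j_s in i_s.
Qed.

Lemma homog_ind (P : V -> Prop) :
  P 0 -> (forall a x y, P x -> P y -> P (a *: x + y)) ->
  (forall n x, homog n x -> P x) -> forall x, P x.
Proof.
move=> P0 PD Ph x; have [s _ ->] := gr_sum x.
elim: s => [|i s IHs]; first by rewrite big_nil.
by rewrite big_cons -[gr_proj _ _ _]scale1r; apply: PD => //; apply/Ph/homog_proj.
Qed.

Lemma homog_ext (U : lmodType k) (f g : {linear V -> U}) :
  (forall n x, homog n x -> f x = g x) -> f =1 g.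
Proof.
move=> fg; apply: homog_ind => [|a x y fx fy|]; first by rewrite !linear0.
  by rewrite !linearP fx fy.
exact: fg.
Qed.

(* The Koszul sign operator [x |-> (-1) ^ (q * |x|) x]. *)
Definition koszul (q : int) : {linear V -> V} :=
  gsum (fun i => (-1 : k) ^ (q * i) \*: idfun).

Lemma koszul_homog q n x : homog n x -> koszul q x = (-1 : k) ^ (q * n) *: x.
Proof. by move=> xn; rewrite (gsum_homog _ xn). Qed.

Lemma koszul0 x : koszul 0 x = x.
Proof.
by move: x; apply: (@homog_ext _ _ idfun) => n x xn; rewrite (koszul_homog _ xn) mul0r scale1r.
Qed.

End GradedTheory.

Section UnitGraded.
Variable k : fieldType.

Fact unit_proj_linear (n : int) : linear (fun x : k^o => if n == 0 then x else 0).
Proof. by move=> a x y; case: eqP => // _; rewrite scaler0 addr0. Qed.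

Definition unit_proj n : {linear k^o -> k^o} := to_linear (unit_proj_linear n).

Fact unit_projK i j x :
  unit_proj i (unit_proj j x) = if i == j then unit_proj j x else 0.
Proof.
rewrite !to_linearE; have [->|] := eqVneq i j; first by case: eqP.
by have [->|] := eqVneq i 0; rewrite // => /negPf; rewrite eq_sym => ->.
Qed.

Fact unit_sum x : exists2 s : seq int, uniq s & x = \sum_(i <- s) unit_proj i x.
Proof. by exists [:: 0] => //; rewrite big_seq1 to_linearE. Qed.

Definition unit_graded : graded k := Graded unit_projK unit_sum.
End UnitGraded.

Section GradedHom.
Variables (k : fieldType) (V W : graded k) (n : int).

(* Hom(V, W)_n *)
Record gHom := GradedHom {
  hom_fun :> {linear V -> W};
  hom_deg : forall i x, homog i x -> homog (i + n) (hom_fun x)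
}.

Lemma hom_ext (f g : gHom) : f =1 g -> f = g.
Proof.
case: f g => f df [g dg] /= /linear_ext fg; case: _ / fg in dg *.
by rewrite (Prop_irrelevance df dg).
Qed.

HB.instance Definition _ := gen_eqMixin gHom.
HB.instance Definition _ := gen_choiceMixin gHom.

Fact hom0_deg i x : homog i x -> homog (i + n) ((\0 : {linear V -> W}) x).
Proof. by move=> _; rewrite /homog linear0. Qed.
Fact homN_deg (f : gHom) i x :
  homog i x -> homog (i + n) ((\- f : {linear V -> W}) x).
Proof. by move=> xi; rewrite /homog linearN (hom_deg f xi). Qed.
Fact homD_deg (f g : gHom) i x :
  homog i x -> homog (i + n) ((f \+ g : {linear V -> W}) x).
Proof. by move=> xi; rewrite /homog linearD (hom_deg f xi) (hom_deg g xi). Qed.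
Fact homZ_deg a (f : gHom) i x :
  homog i x -> homog (i + n) ((a \*: f : {linear V -> W}) x).
Proof. by move=> xi; rewrite /homog linearZ (hom_deg f xi). Qed.

Definition hom0 := GradedHom hom0_deg.
Definition homN f := GradedHom (homN_deg f).
Definition homD f g := GradedHom (homD_deg f g).
Definition homZ a f := GradedHom (homZ_deg a f).

Fact homA : associative homD.
Proof. by move=> f g h; apply: hom_ext => x /=; rewrite addrA. Qed.
Fact homC : commutative homD.
Proof. by move=> f g; apply: hom_ext => x /=; rewrite addrC. Qed.
Fact hom0D : left_id hom0 homD.
Proof. by move=> f; apply: hom_ext => x /=; rewrite add0r. Qed.
Fact homND : left_inverse hom0 homN homD.
Proof. by move=> f; apply: hom_ext => x /=; rewrite addNr. Qed.
HB.instance Definition _ := GRing.isZmodule.Build gHom homA homC hom0D homND.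

Fact homZA a b f : homZ a (homZ b f) = homZ (a * b) f.
Proof. by apply: hom_ext => x /=; rewrite scalerA. Qed.
Fact homZ1 f : homZ 1 f = f.
Proof. by apply: hom_ext => x /=; rewrite scale1r. Qed.
Fact homZDr a : {morph homZ a : f g / f + g}.
Proof. by move=> f g; apply: hom_ext => x /=; rewrite scalerDr. Qed.
Fact homZDl f : {morph homZ ^~ f : a b / a + b}.
Proof. by move=> a b; apply: hom_ext => x /=; rewrite scalerDl. Qed.
HB.instance Definition _ :=
  GRing.Zmodule_isLmodule.Build k gHom homZA homZ1 homZDr homZDl.

Lemma homDE (f g : gHom) x : (f + g) x = f x + g x. Proof. by []. Qed.
Lemma homZE a (f : gHom) x : (a *: f) x = a *: f x. Proof. by []. Qed.
Lemma hom0E x : (0 : gHom) x = 0. Proof. by []. Qed.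

End GradedHom.

Fact id_deg (k : fieldType) (V : graded k) i (x : V) :
  homog i x -> homog (i + 0) ((idfun : {linear V -> V}) x).
Proof. by rewrite addr0. Qed.
Definition idh (k : fieldType) (V : graded k) : gHom V V 0 := GradedHom (@id_deg k V).
Arguments idh {k} V.

Section HomComp.
Variables (k : fieldType) (U V W : graded k) (n : int).

Fact comp0h_deg (g : gHom V W 0) (f : gHom U V n) i x :
  homog i x -> homog (i + n) ((g \o f : {linear U -> W}) x).
Proof. by move/(hom_deg f)/(hom_deg g); rewrite addr0. Qed.
Definition comp0h g f : gHom U W n := GradedHom (@comp0h_deg g f).

Fact comph0_deg (g : gHom V W n) (f : gHom U V 0) i x :
  homog i x -> homog (i + n) ((g \o f : {linear U -> W}) x).
Proof. by move/(hom_deg f)/(hom_deg g); rewrite addr0. Qed.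
Definition comph0 g f : gHom U W n := GradedHom (@comph0_deg g f).
End HomComp.

(* [s] stands for the polynomial [\sum_i s`_i t ^ i] with coefficients in
   Hom(V, W)_n; trailing zeros are allowed. *)
Definition polyhom (k : fieldType) (V W : graded k) (n : int) := seq (gHom V W n).

Definition peval (k : fieldType) (V W : graded k) (n : int)
    (c : k) (s : polyhom V W n) : gHom V W n :=
  \sum_(i < size s) c ^+ i *: s`_i.

Section TensorGraded.
Variables (k : fieldType).
Implicit Types V W : graded k.

(* Plain tensor product of linear maps, without signs *)
Section Tmap.
Variables (V W V' W' : lmodType k) (f : {linear V -> V'}) (g : {linear W -> W'}).
Fact tmap_linearl w : linear (fun v => tpure (f v) (g w)).
Proof.
by move=> a v v'; rewrite -[LHS]/(tpurel (g w) (f (a *: v + v'))) !linearP.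
Qed.
Fact tmap_linearr v : linear (fun w => tpure (f v) (g w)).
Proof. by move=> a w w'; rewrite !linearP. Qed.
Definition tmap : {linear tensor V W -> tensor V' W'} :=
  tlift tmap_linearl tmap_linearr.
Lemma tmapE v w : tmap (tpure v w) = tpure (f v) (g w).
Proof. exact: tliftE. Qed.
End Tmap.

Lemma tensor_homog_ind V W (P : tensor V W -> Prop) :
  P 0 -> (forall a x y, P x -> P y -> P (a *: x + y)) ->
  (forall i j v w, homog i v -> homog j w -> P (tpure v w)) -> forall t, P t.
Proof.
move=> P0 PD Pp; apply: tensor_ind => // v w; move: v w.
apply: (@homog_ind _ V) => [w|a x y Px Py w|i v vi].
- by rewrite -[tpure 0 w]/(tpurel w 0) linear0.
- rewrite -[tpure _ w]/(tpurel w (a *: x + y)) linearPZ; exact: PD (Px w) (Py w).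
apply: (@homog_ind _ W) => [|a x y Px Py|j w wj].
- by rewrite linear0.
- rewrite linearPZ; exact: PD Px Py.
- exact: Pp vi wj.
Qed.

Lemma tensor_homog_ext V W (U : lmodType k) (f g : {linear tensor V W -> U}) :
  (forall i j v w, homog i v -> homog j w -> f (tpure v w) = g (tpure v w)) ->
  f =1 g.
Proof.
move=> fg; apply: tensor_homog_ind => // [|a x y fx fy].
  by rewrite !linear0.
by rewrite !linearP fx fy.
Qed.

Section Bigsum.
Variables (V W : graded k) (U : lmodType k) (h : int -> {linear W -> W}).
(* v (x) w |-> \sum_i v_i (x) h_i w *)
Fact gtens_linearl w : linear (fun v : V => gsum (fun i => tpurel (h i w)) v).
Proof. by move=> a v v'; rewrite linearP. Qed.
Fact gtens_linearr (v : V) : linear (fun w => gsum (fun i => tpurel (h i w)) v).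
Proof.
move=> a w w'; have [s sv] := windowP v.
rewrite !(gsumE _ sv) scaler_sumr -big_split; apply: eq_bigr => i _.
by rewrite -[LHS]/(tpure (gr_proj V i v) (h i (a *: w + w'))) !linearP.
Qed.
Definition gtens : {linear tensor V W -> tensor V W} :=
  tlift gtens_linearl gtens_linearr.
Lemma gtensE i v w : homog i v -> gtens (tpure v w) = tpure v (h i w).
Proof. by move=> vi; rewrite tliftE (gsum_homog _ vi). Qed.
End Bigsum.
Arguments gtens {V W} h.

Section Tensor.
Variables V W : graded k.

(* (V (x) W)_n is the direct sum of the V_i (x) W_(n - i) *)
Definition tensor_proj (n : int) : {linear tensor V W -> tensor V W} :=
  gtens (fun i => gr_proj W (n - i)).


Lemma tensor_proj_homog n i j (v : V) (w : W) : homog i v -> homog j w ->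
  tensor_proj n (tpure v w) = if n == i + j then tpure v w else 0.
Proof.
move=> vi wj; rewrite (@gtensE _ _ _ _ _ _ vi) (homog_projE _ wj) subr_eq addrC.
by case: eqP => // _; rewrite linear0.
Qed.

Fact tensor_projK i j x :
  tensor_proj i (tensor_proj j x) = if i == j then tensor_proj j x else 0.
Proof.
move: x; have [->|ij] := eqVneq i j.
  apply: (@tensor_homog_ext _ _ _ (tensor_proj j \o tensor_proj j)).
  move=> a b v w va wb /=; rewrite (tensor_proj_homog _ va wb).
  case: eqP => [jE|_]; last by rewrite linear0.
  by rewrite (tensor_proj_homog _ va wb) jE eqxx.
apply: (@tensor_homog_ext _ _ _ (tensor_proj i \o tensor_proj j) \0).
move=> a b v w va wb /=; rewrite (tensor_proj_homog _ va wb).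
have [jE|_] := eqVneq j (a + b); last by rewrite linear0.
by rewrite (tensor_proj_homog _ va wb) -jE (negPf ij).
Qed.

Fact tensor_sum x :
  exists2 s : seq int, uniq s & x = \sum_(i <- s) tensor_proj i x.
Proof.
move: x; apply: tensor_homog_ind.
- by exists [::] => //; rewrite big_nil.
- move=> a x y [s us xE] [t ut yE].
  have wE (z : tensor V W) (r r' : seq int) : uniq r -> uniq r' ->
      z = \sum_(i <- r) tensor_proj i z -> {subset r <= r'} ->
      z = \sum_(i <- r') tensor_proj i z.
    move=> ur ur' zE rr'.
    have z0 i : i \notin r -> tensor_proj i z = 0.
      move=> i_r; rewrite zE linear_sum big_seq big1 // => j j_r.
      by rewrite tensor_projK; case: eqP => // ij; rewrite ij j_r in i_r.
    rewrite [LHS]zE [RHS](bigID (mem r)) /= [X in _ = _ + X]big1 ?addr0 //.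
    rewrite -[RHS]big_filter; apply: perm_big; apply: uniq_perm => //.
      exact: filter_uniq.
    by move=> i; rewrite mem_filter andb_idr // => /rr'.
  exists (undup (s ++ t)); first exact: undup_uniq.
  under eq_bigr do rewrite linearP.
  rewrite big_split /= -scaler_sumr -(wE x s) ?undup_uniq //; last first.
    by move=> i i_s; rewrite mem_undup mem_cat i_s.
  by rewrite -(wE y t) ?undup_uniq // => i i_t; rewrite mem_undup mem_cat i_t orbT.
- move=> i j v w vi wj; exists [:: i + j] => //.
  by rewrite big_seq1 (tensor_proj_homog _ vi wj) eqxx.
Qed.

Definition tensor_graded : graded k := Graded tensor_projK tensor_sum.

Lemma tpure_homog i j (v : V) (w : W) :
  homog i v -> homog j w -> @homog k tensor_graded (i + j) (tpure v w).
Proof. by move=> vi wj; rewrite /homog/= (tensor_proj_homog _ vi wj) eqxx. Qed.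

End Tensor.
End TensorGraded.

(* The tensor product of homogeneous maps, with the Koszul sign
   (f (x) g) (v (x) w) = (-1) ^ (|g| |v|) f v (x) g w. *)
Definition tens (k : fieldType) (V W V' W' : graded k) (p q : int)
    (f : gHom V V' p) (g : gHom W W' q) :
    {linear tensor_graded V W -> tensor_graded V' W'} :=
  tmap (f \o koszul V q) g.

Reserved Notation "f ⊗ g" (at level 40, left associativity).
Notation "f ⊗ g" := (tens f g) : ring_scope.

Lemma tensE (k : fieldType) (V W V' W' : graded k) (p q : int)
    (f : gHom V V' p) (g : gHom W W' q) i (v : V) w : homog i v ->
  (f ⊗ g) (tpure v w) = (-1 : k) ^ (q * i) *: tpure (f v) (g w).
Proof.
move=> vi; rewrite [LHS]tmapE /= (koszul_homog _ vi) linearZ.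
by rewrite -[LHS]/(tpurel (g w) _) linearZ.
Qed.

Lemma koszul_hom0 (k : fieldType) (V W : graded k) (f : gHom V W 0) q x :
  f (koszul V q x) = koszul W q (f x).
Proof.
move: x; apply: (@homog_ext _ _ _ (f \o koszul V q) (koszul W q \o f)) => n x xn.
rewrite /= (koszul_homog _ xn) linearZ /=.
by have /(koszul_homog q) -> := hom_deg f xn; rewrite addr0.
Qed.

Section TensComp.
Variables (k : fieldType) (V W V' W' V'' W'' : graded k) (p q : int).

Lemma tens_comp0h (g : gHom V' V'' 0) (g' : gHom W' W'' 0)
    (f : gHom V V' p) (f' : gHom W W' q) x :
  (g ⊗ g') ((f ⊗ f') x) = (comp0h g f ⊗ comp0h g' f') x.
Proof.
move: x; apply: (@tensor_ext _ _ _ _ ((g ⊗ g') \o (f ⊗ f'))) => v w /=.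
by rewrite [(f ⊗ f') _]tmapE [LHS]tmapE [RHS]tmapE /= koszul0.
Qed.

Lemma tens_comph0 (g : gHom V' V'' p) (g' : gHom W' W'' q)
    (f : gHom V V' 0) (f' : gHom W W' 0) x :
  (g ⊗ g') ((f ⊗ f') x) = (comph0 g f ⊗ comph0 g' f') x.
Proof.
move: x; apply: (@tensor_ext _ _ _ _ ((g ⊗ g') \o (f ⊗ f'))) => v w /=.
by rewrite [(f ⊗ f') _]tmapE [LHS]tmapE [RHS]tmapE /= koszul0 -koszul_hom0.
Qed.
End TensComp.

(* Chain complexes, with homological grading *)
Record complex (k : fieldType) := Complex {
  cx_graded :> graded k;
  cx_d : gHom cx_graded cx_graded (-1);
  cx_dd : forall x, cx_d (cx_d x) = 0
}.

Definition unit_complex (k : fieldType) : complex k :=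
  @Complex k (unit_graded k) 0 (fun=> erefl).

Section TensorComplex.
Variables (k : fieldType) (V W : complex k).

Definition tensor_d : {linear tensor_graded V W -> tensor_graded V W} :=
  (cx_d V ⊗ idh W) \+ (idh V ⊗ cx_d W).

Fact tensor_dE i (v : V) (w : W) : homog i v ->
  tensor_d (tpure v w) =
  tpure (cx_d V v) w + (-1 : k) ^ (- i) *: tpure v (cx_d W w).
Proof.
move=> vi; rewrite -[LHS]/((cx_d V ⊗ idh W) (tpure v w) +
                           (idh V ⊗ cx_d W) (tpure v w)).
by rewrite !(tensE _ _ _ vi) mul0r expr0z scale1r mulN1r.
Qed.

Fact tensor_d_deg i x : homog i x -> homog (i + -1) (tensor_d x).
Proof.
have H y : tensor_proj V W (i - 1) (tensor_d y) = tensor_d (tensor_proj V W i y).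
  move: y; apply: (@tensor_homog_ext _ _ _ _ (tensor_proj V W (i - 1) \o tensor_d)
    (tensor_d \o tensor_proj V W i)) => a b v w va wb.
  rewrite -[LHS]/(tensor_proj V W (i - 1) (tensor_d (tpure v w))).
  rewrite -[RHS]/(tensor_d (tensor_proj V W i (tpure v w))).
  rewrite (tensor_dE _ va) linearD linearZZ (tensor_proj_homog _ va wb).
  rewrite (tensor_proj_homog _ (hom_deg (cx_d V) va) wb).
  rewrite (tensor_proj_homog _ va (hom_deg (cx_d W) wb)).
  rewrite addrAC addrA !(inj_eq (addIr _)).
  case: eqP => _; first by rewrite (tensor_dE _ va).
  by rewrite scaler0 addr0 linear0.
move=> xi; rewrite /homog -[LHS]/(tensor_proj V W (i - 1) (tensor_d x)) H.
exact: (congr1 tensor_d xi).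
Qed.

Definition tensor_dh : gHom (tensor_graded V W) (tensor_graded V W) (-1) :=
  GradedHom tensor_d_deg.

Fact tensor_dd x : tensor_dh (tensor_dh x) = 0.
Proof.
move: x; apply: (@tensor_homog_ext _ _ _ _ (tensor_d \o tensor_d) \0).
move=> i j v w vi wj; rewrite -[LHS]/(tensor_d (tensor_d (tpure v w))).
rewrite (tensor_dE _ vi) linearD linearZZ.
rewrite (tensor_dE _ (hom_deg (cx_d V) vi)) (tensor_dE _ vi) !cx_dd.
rewrite -[tpure 0 w]/(tpurel w 0) !linear0 ?scaler0 add0r addr0.
rewrite -scalerDl opprD opprK expfzDr ?oppr_eq0 ?oner_eq0 // expr1z.
by rewrite mulrN1 addNr scale0r.
Qed.

Definition tensor_complex : complex k := Complex tensor_dd.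
End TensorComplex.

(* The element [x |-> dhom f x] of Hom(V, W)_(n - 1) is the differential of f. *)
Definition dhom (k : fieldType) (V W : complex k) (n : int) (f : gHom V W n)
    (x : V) : W :=
  cx_d W (f x) - (-1 : k) ^ n *: f (cx_d V x).

Definition chain_map (k : fieldType) (V W : complex k) (f : gHom V W 0) : Prop :=
  forall x, dhom f x = 0.

Section Structural.
Variable k : fieldType.

Section Unitors.
Variable V : lmodType k.
Fact lunit_linearl (v : V) : linear (fun a : k^o => a *: v).
Proof. by move=> a b c; rewrite scalerDl scalerA. Qed.
Fact lunit_linearr (a : k^o) : linear (fun v : V => a *: v).
Proof. by move=> b v w; rewrite scalerDr !scalerA mulrC. Qed.
Definition lunit : {linear tensor k^o V -> V} := tlift lunit_linearl lunit_linearr.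
Definition runit : {linear tensor V k^o -> V} := tlift lunit_linearr lunit_linearl.
End Unitors.

Section Associator.
Variables U V W : lmodType k.

Fact assoc1_linearl (w : W) (v : V) : linear (fun u : U => tpure u (tpure v w)).
Proof. exact: (linearPZ (tpurel (tpure v w))). Qed.
Fact assoc1_linearr (w : W) (u : U) : linear (fun v : V => tpure u (tpure v w)).
Proof.
move=> a v v'.
by rewrite -[tpure (_ + _) w]/(tpurel w (a *: v + v')) !linearP.
Qed.
Definition assoc1 (w : W) : {linear tensor U V -> tensor U (tensor V W)} :=
  tlift (assoc1_linearl w) (assoc1_linearr w).

Fact assoc_linearl w : linear (assoc1 w). Proof. exact: linearPZ. Qed.
Fact assoc_linearr (t : tensor U V) : linear (assoc1^~ t).
Proof.
move=> a w w'.
move: t; apply: (@tensor_ext _ _ _ _ (assoc1 (a *: w + w'))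
  ((a \*: assoc1 w) \+ assoc1 w')) => u v /=.
by rewrite [LHS]tliftE ![assoc1 _ _]tliftE !linearP.
Qed.
Definition assoc : {linear tensor (tensor U V) W -> tensor U (tensor V W)} :=
  tlift assoc_linearl assoc_linearr.

Fact assocV1_linearl (u : U) (w : W) : linear (fun v : V => tpure (tpure u v) w).
Proof.
by move=> a v v'; rewrite linearP -[LHS]/(tpurel w _) linearP.
Qed.
Fact assocV1_linearr (u : U) (v : V) : linear (fun w : W => tpure (tpure u v) w).
Proof. by move=> a w w'; rewrite linearP. Qed.
Definition assocV1 (u : U) : {linear tensor V W -> tensor (tensor U V) W} :=
  tlift (assocV1_linearl u) (assocV1_linearr u).

Fact assocV_linearl (t : tensor V W) : linear (assocV1^~ t).
Proof.
move=> a u u'.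
move: t; apply: (@tensor_ext _ _ _ _ (assocV1 (a *: u + u'))
  ((a \*: assocV1 u) \+ assocV1 u')) => v w /=.
rewrite [LHS]tliftE ![assocV1 _ _]tliftE -[tpure _ v]/(tpurel v (a *: u + u')).
by rewrite linearP -[LHS]/(tpurel w _) linearP.
Qed.
Fact assocV_linearr u : linear (assocV1 u). Proof. exact: linearPZ. Qed.
Definition assocV : {linear tensor U (tensor V W) -> tensor (tensor U V) W} :=
  tlift assocV_linearl assocV_linearr.

Lemma assocE u v w : assoc (tpure (tpure u v) w) = tpure u (tpure v w).
Proof. by rewrite [LHS]tliftE [LHS]tliftE. Qed.
Lemma assocVE u v w : assocV (tpure u (tpure v w)) = tpure (tpure u v) w.
Proof. by rewrite [LHS]tliftE [LHS]tliftE. Qed.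
End Associator.

Section Braiding.
Variables V W : graded k.
Fact braid_linearl (w : W) :
  linear (fun v : V => gsum (fun i => tpure (koszul W i w)) v).
Proof. exact: linearPZ. Qed.
Fact braid_linearr (v : V) :
  linear (fun w : W => gsum (fun i => tpure (koszul W i w)) v).
Proof.
move=> a w w'; have [s sv] := windowP v.
rewrite !(gsumE _ sv) scaler_sumr -big_split; apply: eq_bigr => i _.
rewrite -[LHS]/(tpurel (gr_proj V i v) (koszul W i (a *: w + w'))).
by rewrite !linearP.
Qed.
Definition braid : {linear tensor V W -> tensor W V} :=
  tlift braid_linearl braid_linearr.

Lemma braidE i j (v : V) (w : W) : homog i v -> homog j w ->
  braid (tpure v w) = (-1 : k) ^ (i * j) *: tpure w v.
Proof.
move=> vi wj; rewrite [LHS]tliftE (gsum_homog _ vi) (koszul_homog _ wj).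
by rewrite -[LHS]/(tpurel v _) linearZ.
Qed.
End Braiding.

Definition tensor_exchange (A B C D : graded k) :
    {linear tensor (tensor A B) (tensor C D) -> tensor (tensor A C) (tensor B D)} :=
  assocV A C (tensor B D)
  \o (tmap idfun (assoc C B D \o (tmap (braid B C) idfun \o assocV B C D))
  \o assoc A B (tensor C D)).

End Structural.
Arguments lunit {k} V.
Arguments runit {k} V.
Arguments assoc {k} U V W.
Arguments assocV {k} U V W.
Arguments braid {k} V W.
Arguments tensor_exchange {k} A B C D.

Lemma tpureZl (k : fieldType) (V W : lmodType k) a (v : V) (w : W) :
  tpure (a *: v) w = a *: tpure v w.
Proof. exact: (linearZZ (tpurel w)). Qed.
Lemma tpureZr (k : fieldType) (V W : lmodType k) a (v : V) (w : W) :
  tpure v (a *: w) = a *: tpure v w.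
Proof. exact: linearZZ. Qed.

Lemma tensor_exchangeE (k : fieldType) (A B C D : graded k) i j
    (a : A) (b : B) (c : C) (d : D) : homog i b -> homog j c ->
  tensor_exchange A B C D (tpure (tpure a b) (tpure c d)) =
  (-1 : k) ^ (i * j) *: tpure (tpure a c) (tpure b d).
Proof.
move=> bi cj; rewrite -[LHS]/(assocV A C (tensor B D) (tmap idfun
  (assoc C B D \o (tmap (braid B C) idfun \o assocV B C D))
  (assoc A B (tensor C D) (tpure (tpure a b) (tpure c d))))).
rewrite assocE tmapE.
rewrite -[X in tpure _ X]/(assoc C B D (tmap (braid B C) idfun
  (assocV B C D (tpure b (tpure c d))))).
by rewrite assocVE tmapE (braidE bi cj) tpureZl linearZZ assocE tpureZr linearZZ
  assocVE.
Qed.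

Record ccdgCoalgebra (k : fieldType) := CcdgCoalgebra {
  coalg_cx :> complex k;
  counit : gHom coalg_cx (unit_complex k) 0;
  comul : gHom coalg_cx (tensor_complex coalg_cx coalg_cx) 0;
  counit_chain : chain_map counit;
  comul_chain : chain_map comul;
  counitl : forall x, lunit coalg_cx ((counit ⊗ idh coalg_cx) (comul x)) = x;
  counitr : forall x, runit coalg_cx ((idh coalg_cx ⊗ counit) (comul x)) = x;
  coassoc : forall x,
    assoc coalg_cx coalg_cx coalg_cx ((comul ⊗ idh coalg_cx) (comul x)) =
    (idh coalg_cx ⊗ comul) (comul x);
  cocomm : forall x, braid coalg_cx coalg_cx (comul x) = comul x
}.
Arguments counit {k} C : rename.
Arguments comul {k} C : rename.

(* [f] sends the unit and the product of A to those of B. *)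
Definition alg_morphism (k : fieldType) (A B : graded k)
    (uA : k^o -> A) (mA : tensor_graded A A -> A)
    (uB : k^o -> B) (mB : tensor_graded B B -> B) (f : gHom A B 0) : Prop :=
  (forall a, f (uA a) = uB a) /\ (forall x, f (mA x) = mB ((f ⊗ f) x)).

Record ccdgHopf (k : fieldType) := CcdgHopf {
  hopf_coalg :> ccdgCoalgebra k;
  hunit : gHom (unit_complex k) hopf_coalg 0;
  hmul : gHom (tensor_complex hopf_coalg hopf_coalg) hopf_coalg 0;
  antipode : gHom hopf_coalg hopf_coalg 0;
  hunit_chain : chain_map hunit;
  hmul_chain : chain_map hmul;
  hmul1l : forall x, hmul ((hunit ⊗ idh hopf_coalg) x) = lunit hopf_coalg x;
  hmul1r : forall x, hmul ((idh hopf_coalg ⊗ hunit) x) = runit hopf_coalg x;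
  hmulA : forall x, hmul ((hmul ⊗ idh hopf_coalg) x) =
    hmul ((idh hopf_coalg ⊗ hmul) (assoc hopf_coalg hopf_coalg hopf_coalg x));
  counit_alg : @alg_morphism k hopf_coalg (unit_complex k)
    hunit hmul idfun (lunit k^o) (counit hopf_coalg);
  (* The product of [O (x) O] is [(hmul (x) hmul) \o tensor_exchange]. *)
  comul_alg : @alg_morphism k hopf_coalg (tensor_complex hopf_coalg hopf_coalg)
    hunit hmul
    (fun a => (hunit ⊗ hunit) (tpure a (1 : k^o)))
    (fun x => (hmul ⊗ hmul)
      (tensor_exchange hopf_coalg hopf_coalg hopf_coalg hopf_coalg x))
    (comul hopf_coalg);
  antipodel : forall x,
    hmul ((antipode ⊗ idh hopf_coalg) (comul hopf_coalg x)) =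
    hunit (counit hopf_coalg x);
  antipoder : forall x,
    hmul ((idh hopf_coalg ⊗ antipode) (comul hopf_coalg x)) =
    hunit (counit hopf_coalg x)
}.
Arguments hunit {k} O : rename.
Arguments hmul {k} O : rename.
Arguments antipode {k} O : rename.

(* d/dt f(t) = \partial xi(t) *)
Definition deriv_eq (k : fieldType) (V W : complex k)
    (f : polyhom V W 0) (xi : polyhom V W 1) : Prop :=
  forall n x, n.+1%:R *: (f`_n.+1) x = dhom (xi`_n) x.

Section Coalgebra.
Variable k : fieldType.
Implicit Types C D : ccdgCoalgebra k.

Definition is_coalg_mor C D (f : gHom C D 0) : Prop :=
  [/\ chain_map f,
      forall x, counit D (f x) = counit C x &
      forall x, comul D (f x) = (f ⊗ f) (comul C x)].

Record coalgMor C D := CoalgMor {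
  coalg_mor :> gHom C D 0;
  coalg_morP : is_coalg_mor coalg_mor
}.

(* Products of polynomials in t are compared coefficientwise. *)
Definition coalg_htpy_pair C D (f : polyhom C D 0) (xi : polyhom C D 1) : Prop :=
  [/\ deriv_eq f xi,
      is_coalg_mor (peval 0 f),
      forall n x, counit D (xi`_n x) = 0 &
      forall n x, comul D (xi`_n x) =
        \sum_(i < n.+1) ((f`_i ⊗ xi`_(n - i)) (comul C x) +
                         (xi`_i ⊗ f`_(n - i)) (comul C x))].

Definition coalg_htpic C D (f g : coalgMor C D) : Prop :=
  exists F xi, [/\ coalg_htpy_pair F xi, peval 0 F = f & peval 1 F = g].
End Coalgebra.

Section Hopf.
Variable k : fieldType.
Implicit Types O P : ccdgHopf k.

Definition is_hopf_mor O P (f : gHom O P 0) : Prop :=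
  is_coalg_mor f /\ alg_morphism (hunit O) (hmul O) (hunit P) (hmul P) f.

Record hopfMor O P := HopfMor {
  hopf_mor :> gHom O P 0;
  hopf_morP : is_hopf_mor hopf_mor
}.

Definition hopf_htpy_pair O P (f : polyhom O P 0) (xi : polyhom O P 1) : Prop :=
  [/\ coalg_htpy_pair f xi,
      alg_morphism (hunit O) (hmul O) (hunit P) (hmul P) (peval 0 f),
      forall n a, xi`_n (hunit O a) = 0 &
      forall n x, xi`_n (hmul O x) =
        \sum_(i < n.+1) (hmul P ((f`_i ⊗ xi`_(n - i)) x) +
                         hmul P ((xi`_i ⊗ f`_(n - i)) x))].

Definition hopf_htpic O P (f g : hopfMor O P) : Prop :=
  exists F xi, [/\ hopf_htpy_pair F xi, peval 0 F = f & peval 1 F = g].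
End Hopf.

Section Tangential.
Variables (k : fieldType) (C : ccdgCoalgebra k) (O : ccdgHopf k).

Definition thom_e : gHom C O 0 := comp0h (hunit O) (counit C).

Definition is_thom (v : gHom C O 0) : Prop :=
  [/\ chain_map v,
      forall x, counit O (v x) = 0 &
      forall x, comul O (v x) =
        (thom_e ⊗ v) (comul C x) + (v ⊗ thom_e) (comul C x)].

Record THom := ThomMor {
  thom_mor :> gHom C O 0;
  thom_morP : is_thom thom_mor
}.

Definition thom_htpy_pair (v : polyhom C O 0) (s : polyhom C O 1) : Prop :=
  [/\ deriv_eq v s,
      is_thom (peval 0 v),
      forall n x, counit O (s`_n x) = 0 &
      forall n x, comul O (s`_n x) =
        (thom_e ⊗ s`_n) (comul C x) + (s`_n ⊗ thom_e) (comul C x)].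

Definition thom_htpic (v w : THom) : Prop :=
  exists u s, [/\ thom_htpy_pair u s, peval 0 u = v & peval 1 u = w].
End Tangential.

(* The quotient of T by the equivalence relation generated by R, with the
   equivalence classes as elements. *)
Section Classes.
Local Open Scope classical_set_scope.
Variables (T : Type) (R : T -> T -> Prop).
Notation gen := (Relation_Operators.clos_refl_sym_trans T R).

Definition rclasses : Type := {A : set T | exists x, A = [set y | gen x y]}.
Definition rclass (x : T) : rclasses :=
  exist _ [set y | gen x y] (ex_intro _ x erefl).

Lemma rclass_surj (c : rclasses) : exists x, c = rclass x.
Proof.
by case: c => A [x AE]; exists x; subst A; congr exist; exact: Prop_irrelevance.
Qed.

Lemma rclassP x y : rclass x = rclass y <-> gen x y.
Proof.
split=> [[/(congr1 (@^~ y)) /= ->]|xy]; first by constructor.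
apply: eq_exist; apply/seteqP; split=> z.
  exact/Relation_Operators.rst_trans/Relation_Operators.rst_sym.
exact: Relation_Operators.rst_trans.
Qed.

Lemma rclass_rel x y : R x y -> rclass x = rclass y.
Proof. by move=> xy; apply/rclassP; constructor. Qed.
End Classes.

Record category := Category {
  obj :> Type;
  Mor : obj -> obj -> Type;
  idm : forall x, Mor x x;
  cmp : forall x y z, Mor y z -> Mor x y -> Mor x z;
  cmp1m : forall x y (f : Mor x y), cmp (idm y) f = f;
  cmpm1 : forall x y (f : Mor x y), cmp f (idm x) = f;
  cmpA : forall w x y z (h : Mor y z) (g : Mor x y) (f : Mor w x),
    cmp h (cmp g f) = cmp (cmp h g) f
}.
Arguments idm {c} x.
Arguments cmp {c x y z} g f : rename.

Definition op (C : category) : category :=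
  @Category C (fun x y => Mor y x) (fun x => idm x)
    (fun x y z (g : Mor z y) (f : Mor y x) => cmp f g)
    (fun x y f => cmpm1 f) (fun x y f => cmp1m f)
    (fun w x y z h g f => esym (cmpA f g h)).

(* Functors with a given action on objects *)
Record functor (C D : category) (F : C -> D) := Functor {
  fmap :> forall x y, Mor x y -> Mor (F x) (F y);
  fmap1 : forall x, fmap (idm x) = idm (F x);
  fmapM : forall x y z (g : Mor y z) (f : Mor x y),
    fmap (cmp g f) = cmp (fmap g) (fmap f)
}.

Record nattrans (C D : category) (F G : C -> D) (TF : functor F) (TG : functor G)
    := Nattrans {
  ncomp :> forall x, Mor (F x) (G x);
  ncomp_natural : forall x y (f : Mor x y),
    cmp (ncomp y) (fmap TF f) = cmp (fmap TG f) (ncomp x)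
}.

Definition is_iso (C : category) (x y : C) (f : Mor x y) : Prop :=
  exists g : Mor y x, cmp g f = idm x /\ cmp f g = idm y.

Definition is_natiso (C D : category) (F G : C -> D) (TF : functor F)
    (TG : functor G) (N : nattrans TF TG) : Prop :=
  forall x, is_iso (N x).

(* A category with a notion of homotopy between parallel morphisms that is
   stable under composition on both sides *)
Record htpy_category := HtpyCategory {
  htpy_cat :> category;
  htpic : forall x y : htpy_cat, Mor x y -> Mor x y -> Prop;
  htpic_cmpl : forall x y z (g : Mor y z) (f f' : @Mor htpy_cat x y),
    htpic f f' -> htpic (cmp g f) (cmp g f');
  htpic_cmpr : forall x y z (f : Mor x y) (g g' : @Mor htpy_cat y z),
    htpic g g' -> htpic (cmp g f) (cmp g' f)
}.

Definition htpy_equiv (C : htpy_category) (x y : C) (f : Mor x y) : Prop :=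
  exists h : Mor y x, htpic (cmp h f) (idm x) /\ htpic (cmp f h) (idm y).

Section HomotopyCategory.
Variable C : htpy_category.

Definition htype (x y : C) : Type := rclasses (@htpic C x y).
Definition htype_of (x y : C) (f : Mor x y) : htype x y := rclass (@htpic C x y) f.

Lemma htype_cmp (x y z : C) (g g' : Mor y z) (f f' : Mor x y) :
  htype_of g = htype_of g' -> htype_of f = htype_of f' ->
  htype_of (cmp g f) = htype_of (cmp g' f').
Proof.
move=> /rclassP gg' /rclassP ff'.
transitivity (htype_of (cmp g f')); apply/rclassP.
  elim: ff' => [h h' hh'|h|h h' _ IH|h h' h'' _ IH _ IH'].
  - by constructor; apply: htpic_cmpl.
  - exact: Relation_Operators.rst_refl.
  - exact: Relation_Operators.rst_sym.
  - exact: Relation_Operators.rst_trans IH IH'.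
elim: gg' => [h h' hh'|h|h h' _ IH|h h' h'' _ IH _ IH'].
- by constructor; apply: htpic_cmpr.
- exact: Relation_Operators.rst_refl.
- exact: Relation_Operators.rst_sym.
- exact: Relation_Operators.rst_trans IH IH'.
Qed.

Definition htype_repr (x y : C) (p : htype x y) : Mor x y :=
  projT1 (cid (rclass_surj p)).

Lemma htype_reprK (x y : C) (p : htype x y) : htype_of (htype_repr p) = p.
Proof. by rewrite /htype_repr; case: cid. Qed.

Definition htype_comp (x y z : C) (q : htype y z) (p : htype x y) : htype x z :=
  htype_of (cmp (htype_repr q) (htype_repr p)).

Lemma htype_compE (x y z : C) (g : Mor y z) (f : Mor x y) :
  htype_comp (htype_of g) (htype_of f) = htype_of (cmp g f).
Proof. by apply: htype_cmp; apply: htype_reprK. Qed.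

Fact htype_comp1m x y (p : htype x y) : htype_comp (htype_of (idm y)) p = p.
Proof. by rewrite -[p]htype_reprK htype_compE cmp1m. Qed.
Fact htype_compm1 x y (p : htype x y) : htype_comp p (htype_of (idm x)) = p.
Proof. by rewrite -[p]htype_reprK htype_compE cmpm1. Qed.
Fact htype_compA w x y z (r : htype y z) (q : htype x y) (p : htype w x) :
  htype_comp r (htype_comp q p) = htype_comp (htype_comp r q) p.
Proof.
by rewrite -[p]htype_reprK -[q]htype_reprK -[r]htype_reprK !htype_compE cmpA.
Qed.

Definition ho : category :=
  @Category C htype (fun x => htype_of (idm x)) htype_comp
    htype_comp1m htype_compm1 htype_compA.
End HomotopyCategory.

Section Whisker.
Variable k : fieldType.

Lemma chain_mapE (V W : complex k) (f : gHom V W 0) :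
  chain_map f <-> forall x, cx_d W (f x) = f (cx_d V x).
Proof.
split=> cf x; last by rewrite /dhom expr0z scale1r cf subrr.
by have /eqP := cf x; rewrite /dhom expr0z scale1r subr_eq0 => /eqP.
Qed.

Lemma chain_id (V : complex k) : chain_map (idh V).
Proof. exact/chain_mapE. Qed.

Lemma chain_comp (U V W : complex k) (g : gHom V W 0) (f : gHom U V 0) :
  chain_map g -> chain_map f -> chain_map (comp0h g f).
Proof.
by move=> /chain_mapE cg /chain_mapE cf; apply/chain_mapE => x /=; rewrite cg cf.
Qed.

Lemma dhom_comp0h (U V W : complex k) n (g : gHom V W 0) (f : gHom U V n) x :
  chain_map g -> dhom (comp0h g f) x = g (dhom f x).
Proof.
by move=> /chain_mapE cg; rewrite /dhom [in RHS]linearB [in RHS]linearZZ -cg.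
Qed.

Lemma dhom_comph0 (U V W : complex k) n (g : gHom V W n) (f : gHom U V 0) x :
  chain_map f -> dhom (comph0 g f) x = dhom g (f x).
Proof. by move=> /chain_mapE cf; rewrite /dhom /= cf. Qed.

Lemma tens_id (V W : graded k) x : (idh V ⊗ idh W) x = x.
Proof.
move: x; apply: (@tensor_ext _ _ _ _ (idh V ⊗ idh W) idfun) => v w.
by rewrite [LHS]tmapE /= koszul0.
Qed.

Lemma coalg_mor_id (C : ccdgCoalgebra k) : is_coalg_mor (idh C).
Proof. by split=> [|//|x]; [exact: chain_id|rewrite tens_id]. Qed.

Lemma coalg_mor_comp (C D E : ccdgCoalgebra k) (g : gHom D E 0) (f : gHom C D 0) :
  is_coalg_mor g -> is_coalg_mor f -> is_coalg_mor (comp0h g f).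
Proof.
move=> [cg eg dg] [cf ef df]; split=> [|x|x]; first exact: chain_comp.
  by rewrite /= eg ef.
by rewrite -[RHS]tens_comp0h -df -dg.
Qed.

Lemma alg_mor_id (A : graded k) uA mA : @alg_morphism k A A uA mA uA mA (idh A).
Proof. by split=> // x; rewrite tens_id. Qed.

Lemma alg_mor_comp (A B D : graded k) uA mA uB mB uD mD
    (g : gHom B D 0) (f : gHom A B 0) :
  alg_morphism uB mB uD mD g -> alg_morphism uA mA uB mB f ->
  alg_morphism uA mA uD mD (comp0h g f).
Proof.
move=> [ug mg] [uf mf]; split=> [a|x]; first by rewrite /= uf ug.
by rewrite -[(_ ⊗ _) _]tens_comp0h -mg -mf.
Qed.

Section PolyMap.
Variables (V W V' W' : graded k) (n n' : int).
Variable h : gHom V W n -> gHom V' W' n'.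
Hypothesis hL : linear h.

Lemma polymap_nth (s : polyhom V W n) i : (map h s)`_i = h s`_i.
Proof.
have h0 : h 0 = 0 by rewrite -[h]/(linear_fun hL) linear0.
have [lt_i|ge_i] := ltnP i (size s); first by rewrite (nth_map 0).
by rewrite !nth_default ?size_map.
Qed.

Lemma peval_map c (s : polyhom V W n) : peval c (map h s) = h (peval c s).
Proof.
rewrite /peval size_map -[h]/(linear_fun hL) linear_sum.
by apply: eq_bigr => i _; rewrite linearZ polymap_nth.
Qed.
End PolyMap.

Lemma comp0h_linear (U V W : graded k) n (g : gHom V W 0) :
  linear (@comp0h k U V W n g).
Proof. by move=> a f f'; apply: hom_ext => x; rewrite /= linearP. Qed.

Lemma comph0_linear (U V W : graded k) n (f : gHom U V 0) :
  linear ((@comph0 k U V W n)^~ f).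
Proof. by move=> a g g'; apply: hom_ext => x. Qed.

Lemma comp0hE (U V W : graded k) (g : gHom V W 0) (f : gHom U V 0) :
  comph0 g f = comp0h g f.
Proof. exact: hom_ext. Qed.

Lemma coalg_pair_cmpl (C D E : ccdgCoalgebra k) (g : gHom D E 0) F xi :
  is_coalg_mor g -> @coalg_htpy_pair k C D F xi ->
  @coalg_htpy_pair k C E (map (comp0h g) F) (map (comp0h g) xi).
Proof.
move=> gM [dF F0 exi dxi]; have [cg eg dg] := gM; split=> [n x||n x|n x].
- rewrite !(polymap_nth (comp0h_linear g)) (dhom_comp0h _ _ cg) -dF.
  by rewrite /= linearZ.
- by rewrite (peval_map (comp0h_linear g)); apply: coalg_mor_comp.
- by rewrite (polymap_nth (comp0h_linear g)) -[LHS]/(counit E (g _)) eg exi.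
- rewrite (polymap_nth (comp0h_linear g)) /= dg dxi linear_sum.
  apply: eq_bigr => i _; rewrite [LHS]linearD.
  by congr (_ + _); rewrite [LHS]tens_comp0h !(polymap_nth (comp0h_linear g)).
Qed.

Lemma coalg_pair_cmpr (C D E : ccdgCoalgebra k) (f : gHom C D 0) G xi :
  is_coalg_mor f -> @coalg_htpy_pair k D E G xi ->
  @coalg_htpy_pair k C E (map ((@comph0 _ _ _ _ _)^~ f) G)
    (map ((@comph0 _ _ _ _ _)^~ f) xi).
Proof.
move=> fM [dG G0 exi dxi]; have [cf ef df] := fM.
have nthE n := @polymap_nth D E C E n n _ (comph0_linear f).
split=> [n x||n x|n x].
- by rewrite !nthE (dhom_comph0 _ _ cf) -dG.
- by rewrite (peval_map (comph0_linear f)) comp0hE; apply: coalg_mor_comp.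
- by rewrite nthE /= exi.
- rewrite nthE /= dxi df; apply: eq_bigr => i _.
  by congr (_ + _); rewrite [LHS]tens_comph0 !nthE.
Qed.

Lemma hopf_pair_cmpl (O P Q : ccdgHopf k) (g : gHom P Q 0) F xi :
  is_hopf_mor g -> @hopf_htpy_pair k O P F xi ->
  @hopf_htpy_pair k O Q (map (comp0h g) F) (map (comp0h g) xi).
Proof.
move=> [gM [ug mg]] [pF F0 uxi mxi]; split=> [|||].
- exact: coalg_pair_cmpl.
- by rewrite (peval_map (comp0h_linear g)); exact: alg_mor_comp (conj ug mg) F0.
- by move=> n a; rewrite (polymap_nth (comp0h_linear g)) /= uxi linear0.
- move=> n x; rewrite (polymap_nth (comp0h_linear g)) /= mxi linear_sum.
  apply: eq_bigr => i _; rewrite [LHS]linearD.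
  congr (_ + _); rewrite [LHS]mg; congr (hmul Q _);
    by rewrite [LHS]tens_comp0h !(polymap_nth (comp0h_linear g)).
Qed.

Lemma hopf_pair_cmpr (O P Q : ccdgHopf k) (f : gHom O P 0) G xi :
  is_hopf_mor f -> @hopf_htpy_pair k P Q G xi ->
  @hopf_htpy_pair k O Q (map ((@comph0 _ _ _ _ _)^~ f) G)
    (map ((@comph0 _ _ _ _ _)^~ f) xi).
Proof.
move=> [fM [uf mf]] [pG G0 uxi mxi].
have nthE n := @polymap_nth P Q O Q n n _ (comph0_linear f).
split=> [|||].
- exact: coalg_pair_cmpr.
- by rewrite (peval_map (comph0_linear f)) comp0hE;
    exact: alg_mor_comp G0 (conj uf mf).
- by move=> n a; rewrite nthE /= uf uxi.
- move=> n x; rewrite nthE /= mf mxi; apply: eq_bigr => i _.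
  by congr (_ + _); congr (hmul Q _); rewrite [LHS]tens_comph0 !nthE.
Qed.
End Whisker.

Section CoalgebraCategory.
Variable k : fieldType.

Lemma coalgMor_ext (C D : ccdgCoalgebra k) (f g : coalgMor C D) : f =1 g -> f = g.
Proof.
case: f g => f fM [g gM] /= /hom_ext fg; case: _ / fg in gM *.
by rewrite (Prop_irrelevance fM gM).
Qed.

Definition coalg_id (C : ccdgCoalgebra k) : coalgMor C C :=
  CoalgMor (coalg_mor_id C).
Definition coalg_cmp (C D E : ccdgCoalgebra k) (g : coalgMor D E)
    (f : coalgMor C D) : coalgMor C E :=
  CoalgMor (coalg_mor_comp (coalg_morP g) (coalg_morP f)).

Fact coalg_cmp1m (C D : ccdgCoalgebra k) (f : coalgMor C D) : coalg_cmp (coalg_id D) f = f.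
Proof. by apply: coalgMor_ext => x. Qed.
Fact coalg_cmpm1 (C D : ccdgCoalgebra k) (f : coalgMor C D) : coalg_cmp f (coalg_id C) = f.
Proof. by apply: coalgMor_ext => x. Qed.
Fact coalg_cmpA (B C D E : ccdgCoalgebra k) (h : coalgMor D E) (g : coalgMor C D) (f : coalgMor B C) :
  coalg_cmp h (coalg_cmp g f) = coalg_cmp (coalg_cmp h g) f.
Proof. by apply: coalgMor_ext => x. Qed.
Definition ccdgC_cat : category := @Category (ccdgCoalgebra k) _ _ _ coalg_cmp1m coalg_cmpm1 coalg_cmpA.

Fact coalg_htpic_cmpl (C D E : ccdgCoalgebra k) (g : coalgMor D E)
    (f f' : coalgMor C D) :
  coalg_htpic f f' -> coalg_htpic (coalg_cmp g f) (coalg_cmp g f').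
Proof.
move=> [F [xi [pF F0 F1]]].
exists (map (comp0h g) F), (map (comp0h g) xi); split.
- exact: coalg_pair_cmpl (coalg_morP g) pF.
- by rewrite (peval_map (comp0h_linear g)) F0.
- by rewrite (peval_map (comp0h_linear g)) F1.
Qed.

Fact coalg_htpic_cmpr (C D E : ccdgCoalgebra k) (f : coalgMor C D)
    (g g' : coalgMor D E) :
  coalg_htpic g g' -> coalg_htpic (coalg_cmp g f) (coalg_cmp g' f).
Proof.
move=> [G [xi [pG G0 G1]]].
exists (map ((@comph0 _ _ _ _ _)^~ (coalg_mor f)) G),
       (map ((@comph0 _ _ _ _ _)^~ (coalg_mor f)) xi); split.
- exact: coalg_pair_cmpr (coalg_morP f) pG.
- by rewrite (peval_map (comph0_linear f)) G0 comp0hE.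
- by rewrite (peval_map (comph0_linear f)) G1 comp0hE.
Qed.

Definition ccdgC : htpy_category :=
  @HtpyCategory ccdgC_cat (@coalg_htpic k) coalg_htpic_cmpl coalg_htpic_cmpr.

Lemma hopfMor_ext (O P : ccdgHopf k) (f g : hopfMor O P) : f =1 g -> f = g.
Proof.
case: f g => f fM [g gM] /= /hom_ext fg; case: _ / fg in gM *.
by rewrite (Prop_irrelevance fM gM).
Qed.

Lemma hopf_mor_id (O : ccdgHopf k) : is_hopf_mor (idh O).
Proof. by split; [exact: coalg_mor_id|exact: alg_mor_id]. Qed.

Lemma hopf_mor_comp (O P Q : ccdgHopf k) (g : gHom P Q 0) (f : gHom O P 0) :
  is_hopf_mor g -> is_hopf_mor f -> is_hopf_mor (comp0h g f).
Proof.
move=> [cg ag] [cf af]; split; [exact: coalg_mor_comp|exact: alg_mor_comp ag af].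
Qed.

Definition hopf_id (O : ccdgHopf k) : hopfMor O O := HopfMor (hopf_mor_id O).
Definition hopf_cmp (O P Q : ccdgHopf k) (g : hopfMor P Q) (f : hopfMor O P) :
    hopfMor O Q :=
  HopfMor (hopf_mor_comp (hopf_morP g) (hopf_morP f)).

Fact hopf_cmp1m (C D : ccdgHopf k) (f : hopfMor C D) : hopf_cmp (hopf_id D) f = f.
Proof. by apply: hopfMor_ext => x. Qed.
Fact hopf_cmpm1 (C D : ccdgHopf k) (f : hopfMor C D) : hopf_cmp f (hopf_id C) = f.
Proof. by apply: hopfMor_ext => x. Qed.
Fact hopf_cmpA (B C D E : ccdgHopf k) (h : hopfMor D E) (g : hopfMor C D) (f : hopfMor B C) :
  hopf_cmp h (hopf_cmp g f) = hopf_cmp (hopf_cmp h g) f.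
Proof. by apply: hopfMor_ext => x. Qed.
Definition ccdgH_cat : category := @Category (ccdgHopf k) _ _ _ hopf_cmp1m hopf_cmpm1 hopf_cmpA.

Fact hopf_htpic_cmpl (O P Q : ccdgHopf k) (g : hopfMor P Q) (f f' : hopfMor O P) :
  hopf_htpic f f' -> hopf_htpic (hopf_cmp g f) (hopf_cmp g f').
Proof.
move=> [F [xi [pF F0 F1]]].
exists (map (comp0h g) F), (map (comp0h g) xi); split.
- exact: hopf_pair_cmpl (hopf_morP g) pF.
- by rewrite (peval_map (comp0h_linear g)) F0.
- by rewrite (peval_map (comp0h_linear g)) F1.
Qed.

Fact hopf_htpic_cmpr (O P Q : ccdgHopf k) (f : hopfMor O P) (g g' : hopfMor P Q) :
  hopf_htpic g g' -> hopf_htpic (hopf_cmp g f) (hopf_cmp g' f).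
Proof.
move=> [G [xi [pG G0 G1]]].
exists (map ((@comph0 _ _ _ _ _)^~ (hopf_mor f)) G),
       (map ((@comph0 _ _ _ _ _)^~ (hopf_mor f)) xi); split.
- exact: hopf_pair_cmpr (hopf_morP f) pG.
- by rewrite (peval_map (comph0_linear f)) G0 comp0hE.
- by rewrite (peval_map (comph0_linear f)) G1 comp0hE.
Qed.

Definition ccdgH : htpy_category :=
  @HtpyCategory ccdgH_cat (@hopf_htpic k) hopf_htpic_cmpl hopf_htpic_cmpr.
End CoalgebraCategory.

HB.mixin Record Lmodule_isLie (k : fieldType) V of GRing.Lmodule k V := {
  lie : V -> V -> V;
  lie_linearl : forall y, linear (lie^~ y);
  lie_linearr : forall x, linear (lie x);
  liexx : forall x, lie x x = 0;
  lie_jacobi : forall x y z,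
    lie x (lie y z) + lie y (lie z x) + lie z (lie x y) = 0
}.
#[short(type="lieAlgType")]
HB.structure Definition LieAlgebra (k : fieldType) :=
  {V of Lmodule_isLie k V & GRing.Lmodule k V}.

(* The Lie algebra with underlying set T given by a Lie algebra structure on T *)
Definition lie_structure (k : fieldType) (T : Type) := LieAlgebra.axioms_ k T.
Definition lie_alg (k : fieldType) (T : Type) (s : lie_structure k T) :
  lieAlgType k := LieAlgebra.Pack s.

Section LieCategory.
Variable k : fieldType.

Record lieMor (L M : lieAlgType k) := LieMor {
  lie_mor :> {linear L -> M};
  lie_morM : forall x y, lie_mor (lie x y) = lie (lie_mor x) (lie_mor y)
}.

Lemma lieMor_ext (L M : lieAlgType k) (f g : lieMor L M) : f =1 g -> f = g.
Proof.
case: f g => f fM [g gM] /= /linear_ext fg; case: _ / fg in gM *.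
by rewrite (Prop_irrelevance fM gM).
Qed.

Definition lie_id (L : lieAlgType k) : lieMor L L :=
  @LieMor L L idfun (fun _ _ => erefl).

Fact lie_cmpM (L M N : lieAlgType k) (g : lieMor M N) (f : lieMor L M) x y :
  (g \o f) (lie x y) = lie ((g \o f) x) ((g \o f) y).
Proof. by rewrite /= !lie_morM. Qed.
Definition lie_cmp (L M N : lieAlgType k) (g : lieMor M N) (f : lieMor L M) :
    lieMor L N :=
  @LieMor L N (g \o f) (lie_cmpM g f).

Fact lie_cmp1m (C D : lieAlgType k) (f : lieMor C D) : lie_cmp (lie_id D) f = f.
Proof. by apply: lieMor_ext => x. Qed.
Fact lie_cmpm1 (C D : lieAlgType k) (f : lieMor C D) : lie_cmp f (lie_id C) = f.
Proof. by apply: lieMor_ext => x. Qed.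
Fact lie_cmpA (B C D E : lieAlgType k) (h : lieMor D E) (g : lieMor C D) (f : lieMor B C) :
  lie_cmp h (lie_cmp g f) = lie_cmp (lie_cmp h g) f.
Proof. by apply: lieMor_ext => x. Qed.
Definition Lie : category := @Category (lieAlgType k) _ _ _ lie_cmp1m lie_cmpm1 lie_cmpA.
End LieCategory.

Section THomHo.
Variables (k : fieldType) (C : ccdgCoalgebra k) (O : ccdgHopf k).

Definition THomHo : Type := rclasses (@thom_htpic k C O).
Definition thtype_of (v : THom C O) : THomHo := rclass (@thom_htpic k C O) v.

(* [g] is a tangential morphism, with homotopy type [a] *)
Definition has_thtype (a : THomHo) (g : C -> O) : Prop :=
  exists2 v : THom C O, v =1 g & a = thtype_of v.
End THomHo.

(* Main.v *)
(* Write [f * g] for the convolution [m o (f (x) g) o Delta] of maps from a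
   coalgebra [C] to a Hopf algebra [O], with unit [e].  A degree 0 or 1 map is
   tangential iff it is primitive, [Delta o f = (e (x) f + f (x) e) o Delta], and
   is killed by the counit; since [C] is cocommutative, for primitive [f] and [g]
   the coproduct of [f * g] is
   [e (x) f * g + f * g (x) e + f (x) g + (-1)^(|f||g|) g (x) f] (applied to
   [Delta]), so commutators of tangential maps are tangential and
   [THom C O] is a Lie algebra.  Homotopies are moved around coefficientwise:
   commutators, and composition with morphisms, act on homotopy pairs of
   tangential maps.  In a homotopy pair [(f, xi)] of coalgebra (resp. Hopf)
   morphisms, characteristic 0 lets one solve [f' = d xi] for the coefficients of
   [f], so those of positive degree are killed by the counit (resp. unit), and
   only the terms involving [e] survive in the coproduct of a composite. *)
Require Import Defs.
From HB Require Import structures.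
From mathcomp Require Import all_boot all_order all_algebra.
From mathcomp Require Import boolp ring.
From Stdlib Require Relation_Operators.

Set Implicit Arguments.
Unset Strict Implicit.
Unset Printing Implicit Defensive.
Import GRing.Theory.
Local Open Scope ring_scope.

(** * Tensor products of homogeneous maps *)

Section TensorMaps.
Variable k : fieldType.

Lemma tensor4_homog_ext (A B C D : graded k) (U : lmodType k)
    (f g : {linear tensor (tensor A B) (tensor C D) -> U}) :
  (forall h i j l a b c d, homog h a -> homog i b -> homog j c -> homog l d ->
    f (tpure (tpure a b) (tpure c d)) = g (tpure (tpure a b) (tpure c d))) ->
  f =1 g.
Proof.
move=> fg; apply: tensor_ext => s t; move: s.
apply: (@tensor_homog_ext _ _ _ _ (f \o tpurel t) (g \o tpurel t)).
move=> h i a b ah bi; rewrite /= /tpurel; move: t.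
apply: (@tensor_homog_ext _ _ _ _ (f \o tpure (tpure a b)) (g \o tpure _)).
by move=> j l c d cj dl /=; apply: fg ah bi cj dl.
Qed.

Lemma tmap_comp (V W V' W' V'' W'' : lmodType k)
    (f' : {linear V' -> V''}) (g' : {linear W' -> W''})
    (f : {linear V -> V'}) (g : {linear W -> W'}) x :
  tmap f' g' (tmap f g x) = tmap (f' \o f) (g' \o g) x.
Proof.
move: x; apply: (@tensor_ext _ _ _ _ (tmap f' g' \o tmap f g)) => v w /=.
by rewrite !tmapE.
Qed.

Lemma eq_tmap (V W V' W' : lmodType k) (f f' : {linear V -> V'})
    (g g' : {linear W -> W'}) : f =1 f' -> g =1 g' -> tmap f g =1 tmap f' g'.
Proof. by move=> /linear_ext-> /linear_ext->. Qed.

(** The Koszul sign is trivial when the second factor has degree 0, so the sign-free identities for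
    [tmap] apply to structure maps and degree 0 maps. *)
Lemma tens0E (V W V' W' : graded k) p (f : gHom V V' p) (g : gHom W W' 0) x :
  (f ⊗ g) x = tmap f g x.
Proof. by apply: eq_tmap => // v; rewrite /= koszul0. Qed.

Section TensLinear.
Variables (V W V' W' : graded k) (p q : int).

Lemma tens_linearl (g : gHom W W' q) x :
  linear (fun f : gHom V V' p => (f ⊗ g) x).
Proof.
move=> a f f'; move: x; apply: (@tensor_ext _ _ _ _ ((a *: f + f') ⊗ g)
  ((a \*: (f ⊗ g)) \+ (f' ⊗ g))) => v w /=.
by rewrite ![(_ ⊗ _) _]tmapE -[LHS]/(tpurel (g w) _) linearP.
Qed.

Lemma tens_linearr (f : gHom V V' p) x :
  linear (fun g : gHom W W' q => (f ⊗ g) x).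
Proof.
move=> a g g'; move: x; apply: (@tensor_ext _ _ _ _ (f ⊗ (a *: g + g'))
  ((a \*: (f ⊗ g)) \+ (f ⊗ g'))) => v w /=.
by rewrite ![(_ ⊗ _) _]tmapE linearP.
Qed.

Lemma tensDl (f f' : gHom V V' p) (g : gHom W W' q) x :
  ((f + f') ⊗ g) x = (f ⊗ g) x + (f' ⊗ g) x.
Proof. exact: (linearD (linear_fun (tens_linearl g x))). Qed.
Lemma tensDr (f : gHom V V' p) (g g' : gHom W W' q) x :
  (f ⊗ (g + g')) x = (f ⊗ g) x + (f ⊗ g') x.
Proof. exact: (linearD (linear_fun (tens_linearr f x))). Qed.
Lemma tensBl (f f' : gHom V V' p) (g : gHom W W' q) x :
  ((f - f') ⊗ g) x = (f ⊗ g) x - (f' ⊗ g) x.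
Proof. exact: (linearB (linear_fun (tens_linearl g x))). Qed.
Lemma tensBr (f : gHom V V' p) (g g' : gHom W W' q) x :
  (f ⊗ (g - g')) x = (f ⊗ g) x - (f ⊗ g') x.
Proof. exact: (linearB (linear_fun (tens_linearr f x))). Qed.
Lemma tens0l (g : gHom W W' q) x : ((0 : gHom V V' p) ⊗ g) x = 0.
Proof. exact: (linear0 (linear_fun (tens_linearl g x))). Qed.
Lemma tens0r (f : gHom V V' p) x : (f ⊗ (0 : gHom W W' q)) x = 0.
Proof. exact: (linear0 (linear_fun (tens_linearr f x))). Qed.

Lemma tensZl a (f : gHom V V' p) (g : gHom W W' q) x :
  ((a *: f) ⊗ g) x = a *: (f ⊗ g) x.
Proof. exact: (linearZZ (linear_fun (tens_linearl g x))). Qed.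
Lemma tensZr a (f : gHom V V' p) (g : gHom W W' q) x :
  (f ⊗ (a *: g)) x = a *: (f ⊗ g) x.
Proof. exact: (linearZZ (linear_fun (tens_linearr f x))). Qed.

Variable n : int.
Hypothesis pq : p + q = n.

Fact tensh_deg (f : gHom V V' p) (g : gHom W W' q) i x :
  homog i x -> homog (i + n) ((f ⊗ g) x).
Proof.
(* It is enough that [f ⊗ g] intertwines the projections onto degrees [i] and [i + n]; this is
   checked on homogeneous pure tensors. *)
have H y : tensor_proj V' W' (i + n) ((f ⊗ g) y) = (f ⊗ g) (tensor_proj V W i y).
  move: y; apply: (@tensor_homog_ext _ _ _ _ (tensor_proj V' W' (i + n) \o (f ⊗ g))
    ((f ⊗ g) \o tensor_proj V W i)) => a b v w va wb /=.
  rewrite (tensE _ _ _ va) linearZZ.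
  rewrite (tensor_proj_homog _ (hom_deg f va) (hom_deg g wb)).
  rewrite (tensor_proj_homog _ va wb) addrACA pq (inj_eq (addIr n)).
  by case: eqP => _; rewrite ?(tensE _ _ _ va) // scaler0 linear0.
move=> xi; rewrite /homog -[LHS]/(tensor_proj V' W' (i + n) ((f ⊗ g) x)) H.
exact: (congr1 (f ⊗ g) xi).
Qed.
(* [n] and the equation [p + q = n] are parameters, here and below, so that no
   transport along equalities of degrees is needed. *)
Definition tensh f g : gHom (tensor_graded V W) (tensor_graded V' W') n :=
  GradedHom (@tensh_deg f g).
End TensLinear.

Lemma tpureZZ (V W : lmodType k) a b (v : V) (w : W) :
  tpure (a *: v) (b *: w) = (a * b) *: tpure v w.
Proof. by rewrite tpureZl tpureZr scalerA. Qed.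

(** Signs depend only on the parity of the exponent. Naming half of the difference as [d] leaves an
    integer identity that [ring] can settle. *)
Lemma exprN1z_even (m n d : int) : m = n + (d + d) -> (-1 : k) ^ m = (-1) ^ n.
Proof.
move=> ->; have n1 : -1 != 0 :> k by rewrite oppr_eq0 oner_eq0.
by rewrite !expfzDr // -expfzMl mulrNN mulr1 exp1rz mulr1.
Qed.

Lemma koszul_unit q x : koszul (unit_graded k) q x = x.
Proof.
have x0 : homog (V := unit_graded k) 0 x by rewrite /homog /= to_linearE.
by rewrite (koszul_homog _ x0) mulr0 expr0z scale1r.
Qed.

(** Naturality of the middle exchange; the sign is that of moving [g] past [f']. *)
Lemma tensor_exchange_tens (A B C D A' B' C' D' : graded k) (p q r s : int)
    (pq pr qs rs : int) (epq : p + q = pq) (epr : p + r = pr)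
    (eqs : q + s = qs) (ers : r + s = rs)
    (f : gHom A A' p) (g : gHom B B' q) (f' : gHom C C' r) (g' : gHom D D' s) x :
  tensor_exchange A' B' C' D' ((tensh epq f g ⊗ tensh ers f' g') x) =
  (-1 : k) ^ (q * r) *:
    (tensh epr f f' ⊗ tensh eqs g g') (tensor_exchange A B C D x).
Proof.
move: x; apply: (@tensor4_homog_ext _ _ _ _ _
  (tensor_exchange A' B' C' D' \o (tensh epq f g ⊗ tensh ers f' g'))
  ((-1 : k) ^ (q * r) \*: ((tensh epr f f' ⊗ tensh eqs g g') \o
     tensor_exchange A B C D))) => h i j l a b c d ah bi cj dl.
rewrite -[LHS]/(tensor_exchange A' B' C' D'
  ((tensh epq f g ⊗ tensh ers f' g') (tpure (tpure a b) (tpure c d)))).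
rewrite -[RHS]/((-1 : k) ^ (q * r) *: (tensh epr f f' ⊗ tensh eqs g g')
  (tensor_exchange A B C D (tpure (tpure a b) (tpure c d)))).
rewrite (tensor_exchangeE _ _ bi cj) linearZZ.
rewrite (tensE _ _ _ (tpure_homog ah bi)) (tensE _ _ _ (tpure_homog ah cj)).
rewrite -[tensh epq f g _]/((f ⊗ g) _) -[tensh ers _ _ _]/((f' ⊗ g') _).
rewrite -[tensh epr _ _ _]/((f ⊗ f') _) -[tensh eqs _ _ _]/((g ⊗ g') _).
rewrite !(tensE _ _ _ ah) (tensE _ _ _ cj) (tensE _ _ _ bi).
rewrite (tpureZZ _ _ (tpure (f a) (g b)) (tpure (f' c) (g' d))).
rewrite (tpureZZ _ _ (tpure (f a) (f' c)) (tpure (g b) (g' d))) linearZZ.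
rewrite (linearZZ (tensor_exchange A' B' C' D')).
rewrite (tensor_exchangeE _ _ (hom_deg g bi) (hom_deg f' cj)) !scalerA.
have n1 : -1 != 0 :> k by rewrite oppr_eq0 oner_eq0.
rewrite -!expfzDr //; congr (_ *: _); rewrite -eqs -ers.
(* On the left [f'] passes [b] twice, once inside [f' ⊗ g'] and once in the braiding of [g b] with
   [f' c]; on the right it never does. Hence the difference is twice [r * i]. *)
by apply: (@exprN1z_even _ _ (r * i)); ring.
Qed.
End TensorMaps.

(** * Associators, and the symmetry of iterated coproducts of a cocommutative coalgebra *)

Section TensorCoherence.
Variable k : fieldType.

Lemma tmap_id (V W : lmodType k) x : tmap (@idfun V) (@idfun W) x = x.
Proof.
move: x; apply: (@tensor_ext _ _ _ _ (tmap idfun idfun) idfun) => v w.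
by rewrite tmapE.
Qed.

Lemma assocK (U V W : lmodType k) x : assocV U V W (assoc U V W x) = x.
Proof.
move: x; apply: (@tensor_ext _ _ _ _ (assocV U V W \o assoc U V W) idfun) => t w.
move: t; apply: (@tensor_ext _ _ _ _ ((assocV U V W \o assoc U V W) \o tpurel w)
  (tpurel w)) => u v.
by rewrite /= /tpurel assocE assocVE.
Qed.

Lemma assoc_tmap (U V W U' V' W' : lmodType k) (f : {linear U -> U'})
    (g : {linear V -> V'}) (h : {linear W -> W'}) x :
  assoc U' V' W' (tmap (tmap f g) h x) = tmap f (tmap g h) (assoc U V W x).
Proof.
move: x; apply: (@tensor_ext _ _ _ _ (assoc U' V' W' \o tmap (tmap f g) h)
  (tmap f (tmap g h) \o assoc U V W)) => t w; move: t.
apply: (@tensor_ext _ _ _ _ ((assoc U' V' W' \o tmap (tmap f g) h) \o tpurel w)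
  ((tmap f (tmap g h) \o assoc U V W) \o tpurel w)) => u v.
by rewrite /= /tpurel assocE !tmapE assocE.
Qed.

Variable C : ccdgCoalgebra k.

Lemma comul_coassoc x :
  assoc C C C (tmap (comul C) idfun (comul C x)) = tmap idfun (comul C) (comul C x).
Proof.
have := coassoc x.
by rewrite (tens0E (comul C) (idh C)) (tens0E (idh C) (comul C)).
Qed.

(** By coassociativity the first two of the three factors form the coproduct of a single element, so
    cocommutativity allows them to be swapped. *)
Lemma comul_braid3 x :
  assoc C C C (tmap (braid C C) idfun
    (assocV C C C (tmap idfun (comul C) (comul C x)))) =
  tmap idfun (comul C) (comul C x).
Proof.
rewrite -comul_coassoc assocK tmap_comp; congr (assoc _ _ _ _).
by apply: eq_tmap => // y; rewrite /= cocomm.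
Qed.

(** Once the fourfold coproduct is bracketed to the right, the exchange acts only on its last three
    factors, and there it swaps the first two: this is [comul_braid3]. *)
Lemma comul4_exchange x :
  tensor_exchange C C C C ((comul C ⊗ comul C) (comul C x)) =
  (comul C ⊗ comul C) (comul C x).
Proof.
rewrite tens0E; set t := tmap _ _ _.
have tE : assoc C C (tensor C C) t =
    tmap idfun (tmap idfun (comul C) \o comul C) (comul C x).
  (* The coproduct is applied to the left factor first, so that coassociativity can be used before
     the right factor is split. *)
  have -> : t = tmap (tmap idfun idfun) (comul C) (tmap (comul C) idfun (comul C x)).
    by rewrite tmap_comp; apply: eq_tmap => // y; rewrite /= tmap_id.
  rewrite assoc_tmap -[assoc _ _ _ _]/(assoc C C C _) comul_coassoc tmap_comp.
  exact: eq_tmap.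
rewrite -[LHS]/(assocV C C (tensor C C) (tmap idfun (assoc C C C \o
  (tmap (braid C C) idfun \o assocV C C C)) (assoc C C (tensor C C) t))).
rewrite -[RHS](assocK t) tE tmap_comp; congr (assocV _ _ _ _).
by apply: eq_tmap => // y; exact: comul_braid3.
Qed.
End TensorCoherence.

(** * Convolution *)

Section Convolution.
Variables (k : fieldType) (C : ccdgCoalgebra k) (O : ccdgHopf k).
Notation e := (thom_e C O).

Definition conv (p q n : int) (pq : p + q = n) (f : gHom C O p) (g : gHom C O q) :
    gHom C O n :=
  @comp0h k C (tensor_graded O O) O n (hmul O)
    (@comph0 k C (tensor_graded C C) (tensor_graded O O) n (tensh pq f g) (comul C)).

Lemma convE (p q n : int) (pq : p + q = n) f g x :
  conv pq f g x = hmul O ((f ⊗ g) (comul C x)).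
Proof. by []. Qed.

Lemma conv1f (p : int) (p0 : 0 + p = p) f : conv p0 e f = f.
Proof.
apply: hom_ext => x; rewrite convE -[in RHS](counitl x) (tens0E (counit C) (idh C)).
move: (comul C x) => t; move: t.
apply: (@tensor_ext _ _ _ _ (hmul O \o (e ⊗ f))
  (f \o (lunit C \o tmap (counit C) idfun))) => a b.
rewrite -[RHS]/(f (lunit C (tmap (counit C) idfun (tpure a b)))) tmapE tliftE linearZ.
rewrite -[LHS]/(hmul O ((e ⊗ f) (tpure a b))) tmapE.
rewrite -[LHS]/(hmul O (tpure (hunit O (counit C (koszul C p a))) (f b))).
(* The Koszul sign of [f] moves through the counit to the ground field, which lies in degree 0, and
   disappears. *)
rewrite koszul_hom0 koszul_unit.
have := hmul1l (tpure (counit C a : k^o) (f b)).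
by rewrite tens0E tmapE => ->; rewrite tliftE.
Qed.

Lemma convf1 (p : int) (p0 : p + 0 = p) f : conv p0 f e = f.
Proof.
apply: hom_ext => x; rewrite convE (tens0E f e) -[in RHS](counitr x).
rewrite (tens0E (idh C) (counit C)).
move: (comul C x) => t; move: t.
apply: (@tensor_ext _ _ _ _ (hmul O \o (tmap f e))
  (f \o (runit C \o tmap idfun (counit C)))) => a b.
rewrite -[RHS]/(f (runit C (tmap idfun (counit C) (tpure a b)))) tmapE tliftE linearZ.
rewrite -[LHS]/(hmul O ((tmap f e) (tpure a b))) tmapE.
have := hmul1r (tpure (f a) (counit C b : k^o)).
by rewrite tens0E tmapE => ->; rewrite tliftE.
Qed.

(** Combines coassociativity of [C] with associativity of [O]; in degree 0 no sign occurs and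
    everything reduces to [tmap]. *)
Lemma convA (z : 0 + 0 = 0 :> int) (f g h : gHom C O 0) :
  conv z (conv z f g) h = conv z f (conv z g h).
Proof.
apply: hom_ext => x; rewrite !convE (tens0E (conv z f g) h) (tens0E f (conv z g h)).
transitivity (hmul O (tmap (hmul O) idfun (tmap (tmap f g) h
  (tmap (comul C) idfun (comul C x))))).
  rewrite !tmap_comp; congr (hmul O _); apply: eq_tmap => // y.
  by rewrite convE (tens0E f g).
have := hmulA (tmap (tmap f g) h (tmap (comul C) idfun (comul C x))).
rewrite (tens0E (hmul O) (idh O)) (tens0E (idh O) (hmul O)) => ->.
congr (hmul O _); rewrite assoc_tmap comul_coassoc !tmap_comp; apply: eq_tmap => // y.
exact: (congr1 (hmul O) (esym (tens0E g h _))).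
Qed.

Lemma convDl (p q n : int) (pq : p + q = n) f f' g :
  conv pq (f + f') g = conv pq f g + conv pq f' g.
Proof. by apply: hom_ext => x; rewrite homDE !convE tensDl linearD. Qed.

Lemma convDr (p q n : int) (pq : p + q = n) f g g' :
  conv pq f (g + g') = conv pq f g + conv pq f g'.
Proof. by apply: hom_ext => x; rewrite homDE !convE tensDr linearD. Qed.

Lemma convZl (p q n : int) (pq : p + q = n) a f g :
  conv pq (a *: f) g = a *: conv pq f g.
Proof. by apply: hom_ext => x; rewrite homZE !convE tensZl linearZ. Qed.

Lemma convZr (p q n : int) (pq : p + q = n) a f g :
  conv pq f (a *: g) = a *: conv pq f g.
Proof. by apply: hom_ext => x; rewrite homZE !convE tensZr linearZ. Qed.

Definition primitive (n : int) (f : gHom C O n) : Prop := forall x,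
  comul O (f x) = (e ⊗ f) (comul C x) + (f ⊗ e) (comul C x).

(** Primitivity as an equation between homogeneous maps, which can be rewritten inside a tensor
    product. *)
Lemma primitive_comp (n : int) (f : gHom C O n) : primitive f ->
  @comp0h k C O (tensor_graded O O) n (comul O) f =
  @comph0 k C (tensor_graded C C) (tensor_graded O O) n
    (tensh (add0r n) e f + tensh (addr0 n) f e) (comul C).
Proof. by move=> pf; apply: hom_ext => x /=; exact: pf. Qed.

Lemma conv_tens (p q r s m n : int) (pq : p + q = m) (rs : r + s = n)
    (f : gHom C O p) (g : gHom C O q) (f' : gHom C O r) (g' : gHom C O s) x :
  (conv pq f g ⊗ conv rs f' g') x =
  (hmul O ⊗ hmul O) ((tensh pq f g ⊗ tensh rs f' g') ((comul C ⊗ comul C) x)).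
Proof.
rewrite (tens_comph0 (tensh pq f g) (tensh rs f' g') (comul C) (comul C)).
by rewrite (tens_comp0h (hmul O) (hmul O) (comph0 (tensh pq f g) (comul C))
  (comph0 (tensh rs f' g') (comul C))).
Qed.

(** The coproduct of [O] is multiplicative, so the left side is the product of the coproducts of [f]
    and [g]. Expanding both by primitivity gives four terms, and every convolution with the unit [e]
    collapses. *)
Lemma comul_conv (p q n : int) (pq : p + q = n) f g x : primitive f -> primitive g ->
  comul O (conv pq f g x) =
  (e ⊗ conv pq f g) (comul C x) + (-1 : k) ^ (p * q) *: (g ⊗ f) (comul C x) +
  ((f ⊗ g) (comul C x) + (conv pq f g ⊗ e) (comul C x)).
Proof.
move=> /primitive_comp pf /primitive_comp pg.
rewrite convE; have [_ ->] := comul_alg O.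
rewrite (tens_comp0h (comul O) (comul O) f g) pf pg.
set a := tensh _ e f + _; set b := tensh _ e g + _.
rewrite -(tens_comph0 a b (comul C) (comul C)) /a /b {a b}.
set z := (comul C ⊗ comul C) (comul C x).
rewrite tensDl (tensDr (tensh (add0r p) e f)) (tensDr (tensh (addr0 p) f e)).
rewrite 3!(linearD (tensor_exchange O O O O)) 3!(linearD (hmul O ⊗ hmul O)).
(* Each of the four terms is treated alike: exchanging the middle maps costs the Koszul sign, and
   the exchange left on the side of [C] is absorbed by [comul4_exchange]. *)
have ex (a b c d i j ac bd : int) (eac : a + c = ac) (ebd : b + d = bd)
    (ab : a + b = i) (cd : c + d = j) (f1 : gHom C O a) (f2 : gHom C O b)
    (f3 : gHom C O c) (f4 : gHom C O d) :
  (hmul O ⊗ hmul O) (tensor_exchange O O O O ((tensh ab f1 f2 ⊗ tensh cd f3 f4) z)) =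
  (-1 : k) ^ (b * c) *: (conv eac f1 f3 ⊗ conv ebd f2 f4) (comul C x).
  rewrite (tensor_exchange_tens ab eac ebd cd) comul4_exchange.
  by rewrite (linearZZ (hmul O ⊗ hmul O)) -conv_tens.
rewrite (ex _ _ _ _ _ _ _ _ (addr0 0) pq).
rewrite (ex _ _ _ _ _ _ _ _ (add0r q) (addr0 p)).
rewrite (ex _ _ _ _ _ _ _ _ (addr0 p) (add0r q)).
rewrite (ex _ _ _ _ _ _ _ _ pq (addr0 0)).
by rewrite !(mulr0, mul0r) !expr0z !scale1r !conv1f !convf1.
Qed.
End Convolution.

(** * The differential of Hom complexes and its Leibniz rules *)

Section HomDifferential.
Variable k : fieldType.

Section Dhomh.
Variables (V W : complex k) (n m : int).
Hypothesis nm : n - 1 = m.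

Fact dhom_linear (f : gHom V W n) : linear (dhom f).
Proof.
move=> a x y; rewrite /dhom (linearP (cx_d V)) !(linearP f) (linearP (cx_d W)).
rewrite scalerDr scalerBr opprD addrACA.
by rewrite !scalerA mulrC.
Qed.

Fact dhomh_deg (f : gHom V W n) i x :
  homog i x -> homog (i + m) (linear_fun (dhom_linear f) x).
Proof.
move=> xi; rewrite /homog /linear_fun /dhom linearB linearZZ -nm.
have := hom_deg (cx_d W) (hom_deg f xi); rewrite /homog -addrA => ->.
have := hom_deg f (hom_deg (cx_d V) xi).
by rewrite /homog -addrA [-1 + n]addrC => ->.
Qed.

Definition dhomh f : gHom V W m := GradedHom (@dhomh_deg f).

Lemma dhomhE f x : dhomh f x = dhom f x. Proof. by []. Qed.
End Dhomh.

(** Leibniz rule for the tensor product of maps: the sign comes from moving the differential past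
    [f]. *)
Lemma dhom_tens (V W V' W' : complex k) (p q n p' q' : int) (pq : p + q = n)
    (pp : p - 1 = p') (qq : q - 1 = q') (f : gHom V V' p) (g : gHom W W' q) x :
  @dhom k (tensor_complex V W) (tensor_complex V' W') n (tensh pq f g) x =
  (dhomh pp f ⊗ g) x + (-1 : k) ^ p *: (f ⊗ dhomh qq g) x.
Proof.
move: x; apply: (@tensor_homog_ext _ _ _ _
  (linear_fun (@dhom_linear (tensor_complex V W) (tensor_complex V' W') n
    (tensh pq f g)))
  ((dhomh pp f ⊗ g) \+ ((-1 : k) ^ p \*: (f ⊗ dhomh qq g)))) => i j v w vi wj.
rewrite -[LHS]/(tensor_d V' W' ((f ⊗ g) (tpure v w)) -
  (-1 : k) ^ n *: (f ⊗ g) (tensor_d V W (tpure v w))).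
rewrite -[RHS]/((dhomh pp f ⊗ g) (tpure v w) +
  (-1 : k) ^ p *: (f ⊗ dhomh qq g) (tpure v w)).
rewrite (tensor_dE _ vi) (linearD (f ⊗ g)) (linearZZ (f ⊗ g)).
rewrite !(tensE _ _ _ vi) (tensE _ _ _ (hom_deg (cx_d V) vi)).
rewrite (linearZZ (tensor_d V' W')) (tensor_dE _ (hom_deg f vi)) !dhomhE /dhom.
rewrite -[tpure (_ - _) _]/(tpurel (g w) _) (linearB (tpurel (g w))).
rewrite (linearB (tpure (f v))).
rewrite (linearZZ (tpurel (g w))) (linearZZ (tpure (f v))) /tpurel.
rewrite !scalerDr !scalerN !scalerA.
have n1 : -1 != 0 :> k by rewrite oppr_eq0 oner_eq0.
rewrite -!expfzDr // -pq -qq.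
have -> : p + q + q * (i - 1) = q * i + p by ring.
have -> : p + q - i + q * i = p + (q - 1) * i + q by ring.
(* The differential of the tensor product passes [f v], of degree [i + p], with exponent
   [- (i + p)]; the two exponents differ by twice [- p]. *)
have -> : (-1 : k) ^ (q * i + - (i + p)) = (-1) ^ (p + (q - 1) * i).
  by apply: (@exprN1z_even _ _ _ (- p)); ring.
by rewrite opprD [LHS]addrACA.
Qed.

Lemma chain_map_dhomh (V W : complex k) (f : gHom V W 0) :
  chain_map f <-> dhomh (add0r (-1)) f = 0.
Proof.
split=> [cf|f0 x]; first by apply: hom_ext.
by rewrite -(dhomhE (add0r (-1))) f0.
Qed.

Lemma dhomh_linear (V W : complex k) (n m : int) (nm : n - 1 = m) :
  linear (@dhomh V W n m nm).
Proof.
move=> a f g; apply: hom_ext => x.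
rewrite homDE homZE !dhomhE /dhom !homDE !homZE linearP scalerDr scalerBr.
by rewrite !scalerA [a * _]mulrC opprD addrACA.
Qed.

(** The product of [O] and the coproduct of [C] are chain maps, so the Leibniz rule passes from
    tensor products to convolutions. *)
Lemma dhom_conv (C : ccdgCoalgebra k) (O : ccdgHopf k) (p q n p' q' n' : int)
    (pq : p + q = n) (pp : p - 1 = p') (qq : q - 1 = q') (nn : n - 1 = n')
    (pq' : p' + q = n') (qp' : p + q' = n') (f : gHom C O p) (g : gHom C O q) :
  dhomh nn (conv pq f g) =
  conv pq' (dhomh pp f) g + (-1 : k) ^ p *: conv qp' f (dhomh qq g).
Proof.
apply: hom_ext => x; rewrite dhomhE homDE homZE !convE /conv.
rewrite (@dhom_comp0h k _ _ _ _ (hmul O) _ _ (@hmul_chain k O)).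
rewrite (@dhom_comph0 k _ _ _ _ _ (comul C) _ (@comul_chain k C)).
by rewrite (dhom_tens pq pp qq) (linearD (hmul O)) (linearZZ (hmul O)).
Qed.

End HomDifferential.

(** * Tangential morphisms *)

Section Tangential.
Variables (k : fieldType) (C : ccdgCoalgebra k) (O : ccdgHopf k).
Notation e := (thom_e C O).

(** Stated in any degree and without the chain map condition, so that it also covers the degree 1
    coefficients of a homotopy pair. *)
Definition tangential (n : int) (f : gHom C O n) : Prop :=
  (forall x, counit O (f x) = 0) /\ primitive f.

Lemma is_thomE (v : gHom C O 0) : is_thom v <-> chain_map v /\ tangential v.
Proof. by split=> [[]|[? []]]. Qed.

Lemma tangential_lin (n : int) a (f g : gHom C O n) :
  tangential f -> tangential g -> tangential (a *: f + g).
Proof.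
move=> [cf pf] [cg pg]; split=> x.
  by rewrite homDE homZE linearP cf cg scaler0 addr0.
rewrite homDE homZE (linearP (comul O)) pf pg.
rewrite (tensDr e (a *: f) g) (tensDl (a *: f) g e) (tensZr _ e f) (tensZl _ f e).
by rewrite scalerDr addrACA.
Qed.

Lemma tangential0 (n : int) : tangential (0 : gHom C O n).
Proof. by split=> x; rewrite hom0E linear0 // tens0l tens0r addr0. Qed.

Lemma counit_conv (p q n : int) (pq : p + q = n) (f : gHom C O p) (g : gHom C O q) x :
  (forall y, counit O (f y) = 0) -> counit O (conv pq f g x) = 0.
Proof.
move=> cf; rewrite convE; have [_ ->] := counit_alg O.
rewrite tens_comp0h.
have -> : comp0h (counit O) f = 0 by apply: hom_ext => y /=; rewrite cf.
by rewrite tens0l linear0.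
Qed.

(** Agrees with the graded commutator when [p * q = 0], the case in which [tangential_bracket]
    applies. *)
Definition bracket (p q n : int) (pq : p + q = n) (qp : q + p = n)
    (f : gHom C O p) (g : gHom C O q) : gHom C O n := conv pq f g - conv qp g f.

(* The mixed terms [f (x) g] and [g (x) f] of the two coproducts cancel. *)
Lemma tangential_bracket (p q n : int) (pq : p + q = n) (qp : q + p = n) f g :
  p * q = 0 -> tangential f -> tangential g -> tangential (bracket pq qp f g).
Proof.
move=> pq0 [cf pf] [cg pg]; rewrite /bracket; split=> x.
  rewrite -scaleN1r addrC homDE homZE linearP.
  by rewrite !counit_conv // scaler0 addr0.
rewrite (tensBr e) (tensBl _ _ e) (linearB (comul O)).
rewrite (comul_conv pq _ pf pg) (comul_conv qp _ pg pf).
rewrite [q * p]mulrC pq0 expr0z !scale1r.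
have cancel (M : zmodType) (a a' b b' c d : M) :
    a + c + (d + b) - (a' + d + (c + b')) = a - a' + (b - b').
  rewrite [a + c + _]addrACA opprD [LHS]addrACA [a' + d]addrC addrKA.
  by rewrite [c + b]addrC addrKA.
exact: cancel.
Qed.
End Tangential.

(** * The Lie algebra of tangential morphisms, before passing to homotopy types *)

Section ThomLie.
Variables (k : fieldType) (C : ccdgCoalgebra k) (O : ccdgHopf k).
Local Notation T := (THom C O).

Lemma thom_ext (v w : T) : thom_mor v = thom_mor w -> v = w.
Proof.
case: v w => v vP [w wP] /= vw; case: _ / vw in wP *.
by rewrite (Prop_irrelevance vP wP).
Qed.

Lemma thom_chain (v : T) : chain_map v. Proof. by case: (thom_morP v). Qed.
Lemma thom_tangential (v : T) : tangential v.
Proof. by have /is_thomE[] := thom_morP v. Qed.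

Lemma is_thom_lin a (v w : gHom C O 0) :
  is_thom v -> is_thom w -> is_thom (a *: v + w).
Proof.
rewrite !is_thomE !chain_map_dhomh => -[cv tv] [cw tw]; split.
  by rewrite dhomh_linear cv cw scaler0 addr0.
exact: tangential_lin.
Qed.

Lemma is_thom0 : is_thom (0 : gHom C O 0).
Proof.
apply/is_thomE; split; last exact: tangential0.
by apply/chain_map_dhomh; exact: (linear0 (linear_fun (dhomh_linear _))).
Qed.

Lemma is_thomD (v w : gHom C O 0) : is_thom v -> is_thom w -> is_thom (v + w).
Proof. by move=> tv tw; rewrite -[v]scale1r; apply: is_thom_lin. Qed.

Lemma is_thomZ a (v : gHom C O 0) : is_thom v -> is_thom (a *: v).
Proof. by move=> tv; rewrite -[_ *: _]addr0; apply: is_thom_lin is_thom0. Qed.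

Lemma is_thomN (v : gHom C O 0) : is_thom v -> is_thom (- v).
Proof. by move=> tv; rewrite -scaleN1r; exact: is_thomZ. Qed.

Definition thom0 : T := ThomMor is_thom0.
Definition thomD (v w : T) : T := ThomMor (is_thomD (thom_morP v) (thom_morP w)).
Definition thomN (v : T) : T := ThomMor (is_thomN (thom_morP v)).
Definition thomZ a (v : T) : T := ThomMor (is_thomZ a (thom_morP v)).

Lemma bracket_linearl (p q n : int) (pq : p + q = n) (qp : q + p = n) (g : gHom C O q) :
  linear (fun f : gHom C O p => bracket pq qp f g).
Proof.
move=> a f f'; rewrite /bracket convDl convDr convZl convZr.
by rewrite scalerBr opprD addrACA.
Qed.

Lemma bracket_linearr (p q n : int) (pq : p + q = n) (qp : q + p = n) (f : gHom C O p) :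
  linear (bracket pq qp f : gHom C O q -> _).
Proof.
move=> a g g'; rewrite /bracket convDl convDr convZl convZr.
by rewrite scalerBr opprD addrACA.
Qed.

(** Since [v] is a cycle of degree 0, the Leibniz rule leaves only the terms that differentiate [s].
    This gives both the closedness of brackets and their action on homotopies. *)
Lemma dhom_bracket (v : T) (p n : int) (pp : p - 1 = n) (vp : 0 + p = p) (pv : p + 0 = p)
    (vn : 0 + n = n) (nv : n + 0 = n) (s : gHom C O p) :
  dhomh pp (bracket vp pv v s) = bracket vn nv v (dhomh pp s).
Proof.
rewrite /bracket -[conv vp _ _ - _]addrC -scaleN1r dhomh_linear scaleN1r addrC.
rewrite (dhom_conv _ (add0r (-1)) pp pp (etrans (addrC _ _) pp) vn).
rewrite (dhom_conv _ pp (add0r (-1)) pp nv pp).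
have /chain_map_dhomh-> := thom_chain v.
have c0 m m' q (e : m + q = m') (f : gHom C O q) : conv e (0 : gHom C O m) f = 0.
  by apply: hom_ext => x; rewrite convE tens0l linear0.
have c1 m m' q (e : q + m = m') (f : gHom C O q) : conv e f (0 : gHom C O m) = 0.
  by apply: hom_ext => x; rewrite convE tens0r linear0.
by rewrite c0 c1 expr0z scale1r scaler0 add0r addr0.
Qed.

Let z0 : 0 + 0 = 0 :> int := addr0 0.

Lemma is_thom_bracket (v w : T) : is_thom (bracket z0 z0 v w).
Proof.
apply/is_thomE; split.
  apply/chain_map_dhomh.
  rewrite (dhom_bracket v (add0r (-1)) z0 z0 (add0r (-1)) (addr0 (-1)) w).
  have /chain_map_dhomh-> := thom_chain w.
  exact: (linear0 (linear_fun
    (bracket_linearr (add0r (-1)) (addr0 (-1)) (v : gHom C O 0)))).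
by apply: tangential_bracket; rewrite ?mul0r //; exact: thom_tangential.
Qed.

Definition thom_lie (v w : T) : T := ThomMor (is_thom_bracket v w).

Lemma bracket_jacobi (u v w : gHom C O 0) :
  bracket z0 z0 u (bracket z0 z0 v w) + bracket z0 z0 v (bracket z0 z0 w u) +
  bracket z0 z0 w (bracket z0 z0 u v) = 0.
Proof.
have cBl a b c : conv z0 (a - b) c = conv z0 a c - conv z0 b c.
  by rewrite convDl -scaleN1r convZl scaleN1r.
have cBr a b c : conv z0 c (a - b) = conv z0 c a - conv z0 c b.
  by rewrite convDr -scaleN1r convZr scaleN1r.
rewrite /bracket !(cBl, cBr, convA).
(* The letters are the six triple convolutions of [u], [v] and [w]; each occurs once with either
   sign. *)
have cancel (M : zmodType) (a b c d f g : M) :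
    a - b - (c - d) + (c - f - (g - b)) + (g - d - (a - f)) = 0.
  have R (x y z t : M) : x - y - (z - t) = (x - z) + (t - y).
    by rewrite opprB [RHS]addrACA [LHS]addrACA [- y - z]addrC.
  by rewrite !R [X in X + _]addrACA !subrKA addrACA !subrKA !subrr addr0.
exact: cancel.
Qed.

HB.instance Definition _ := gen_eqMixin T.
HB.instance Definition _ := gen_choiceMixin T.

Fact thomA : associative thomD.
Proof. by move=> u v w; apply: thom_ext; apply: addrA. Qed.
Fact thomC : commutative thomD.
Proof. by move=> u v; apply: thom_ext; apply: addrC. Qed.
Fact thom0D : left_id thom0 thomD.
Proof. by move=> u; apply: thom_ext; apply: add0r. Qed.
Fact thomND : left_inverse thom0 thomN thomD.
Proof. by move=> u; apply: thom_ext; apply: addNr. Qed.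
HB.instance Definition _ := GRing.isZmodule.Build T thomA thomC thom0D thomND.

Fact thomZA a b v : thomZ a (thomZ b v) = thomZ (a * b) v.
Proof. by apply: thom_ext; apply: scalerA. Qed.
Fact thomZ1 v : thomZ 1 v = v.
Proof. by apply: thom_ext; apply: scale1r. Qed.
Fact thomZDr a : {morph thomZ a : v w / v + w}.
Proof. by move=> v w; apply: thom_ext; apply: scalerDr. Qed.
Fact thomZDl v : {morph thomZ ^~ v : a b / a + b}.
Proof. by move=> a b; apply: thom_ext; apply: scalerDl. Qed.
HB.instance Definition _ :=
  GRing.Zmodule_isLmodule.Build k T thomZA thomZ1 thomZDr thomZDl.

Fact thom_lie_linearl w : linear (thom_lie^~ w).
Proof. by move=> a u v; apply: thom_ext; apply: bracket_linearl. Qed.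
Fact thom_lie_linearr u : linear (thom_lie u).
Proof. by move=> a v w; apply: thom_ext; apply: bracket_linearr. Qed.
Fact thom_liexx v : thom_lie v v = 0.
Proof. by apply: thom_ext; apply: subrr. Qed.
Fact thom_jacobi u v w :
  thom_lie u (thom_lie v w) + thom_lie v (thom_lie w u) +
  thom_lie w (thom_lie u v) = 0.
Proof. by apply: thom_ext; apply: bracket_jacobi. Qed.
HB.instance Definition _ := Lmodule_isLie.Build k T
  thom_lie_linearl thom_lie_linearr thom_liexx thom_jacobi.
End ThomLie.

(** * Homotopy pairs *)

Section Polynomials.
Variables (k : fieldType) (V W : graded k) (n : int).
Implicit Types s : polyhom V W n.

Lemma peval_cons c (f : gHom V W n) s :
  peval c (f :: s) = f + c *: peval c s.
Proof.
rewrite /peval big_ord_recl /= expr0 scale1r scaler_sumr; congr (_ + _).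
by apply: eq_bigr => i _; rewrite exprS scalerA.
Qed.

Lemma peval0 s : peval 0 s = s`_0.
Proof.
case: s => [|f s]; first by rewrite /peval big_ord0.
by rewrite peval_cons scale0r addr0.
Qed.
End Polynomials.

Section Derivative.
Variables (k : fieldType) (V W : complex k).

Lemma deriv_eq_dhomh (F : polyhom V W 0) (xi : polyhom V W 1) :
  deriv_eq F xi <-> forall n, n.+1%:R *: F`_n.+1 = dhomh (subrr 1) xi`_n.
Proof.
split=> [dF n|dF n x]; first by apply: hom_ext => x; apply: dF.
by rewrite -[LHS]homZE dF.
Qed.
End Derivative.

(** * Operations on homotopy pairs of tangential maps *)

Section ThomHomotopy.
Variable k : fieldType.

(** Linear maps in degrees 0 and 1 that commute with the differential and preserve tangentiality
    transform a homotopy pair coefficient by coefficient. Scaling, bracketing with a fixed map and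
    both kinds of composition are instances. *)
Lemma thom_htpic_map (C C' : ccdgCoalgebra k) (O O' : ccdgHopf k)
    (h0 : gHom C O 0 -> gHom C' O' 0) (h1 : gHom C O 1 -> gHom C' O' 1) :
  linear h0 -> linear h1 ->
  (forall s, dhomh (subrr 1) (h1 s) = h0 (dhomh (subrr 1) s)) ->
  (forall v, is_thom v -> is_thom (h0 v)) ->
  (forall s, tangential s -> tangential (h1 s)) ->
  forall (v v' : THom C O) (w w' : THom C' O'),
    thom_htpic v v' -> thom_mor w = h0 v -> thom_mor w' = h0 v' ->
    thom_htpic w w'.
Proof.
move=> h0L h1L h01 h0P h1P v v' w w' [F [xi [[dF F0 cxi pxi] Fv Fv']]] wE w'E.
exists (map h0 F), (map h1 xi); split; last first.
- by rewrite (peval_map h0L) Fv'.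
- by rewrite (peval_map h0L) Fv.
have tP n : tangential (map h1 xi)`_n.
  by rewrite (polymap_nth h1L); apply: h1P; split.
split; last by move=> n; have [] := tP n.
- apply/deriv_eq_dhomh => n; rewrite (polymap_nth h0L) (polymap_nth h1L) h01.
  have /deriv_eq_dhomh <- := dF.
  exact: esym (linearZZ (linear_fun h0L) _ _).
- by rewrite (peval_map h0L); apply: h0P.
- by move=> n; have [] := tP n.
Qed.

Section Fixed.
Variables (C : ccdgCoalgebra k) (O : ccdgHopf k).
Implicit Types u v w : THom C O.

(** Translation by [u] is affine, not linear, so the pair is built directly: only the constant
    coefficient changes, and the degree 1 part is kept because the derivative is the same. *)
Lemma thom_htpicD u v w : thom_htpic v w -> thom_htpic (u + v) (u + w).
Proof.
move=> [F [xi [[dF F0 cxi pxi] Fv Fw]]].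
(* For empty [F] the constant coefficient read off is the default 0, so the new list is just [u], as
   it should be. *)
have FE c : peval c ((thom_mor u + F`_0) :: behead F) = thom_mor u + peval c F.
  rewrite peval_cons; case: F {dF F0 Fv Fw} => [|f s] /=.
    by rewrite /peval big_ord0 scaler0 addr0.
  by rewrite peval_cons addrA.
exists ((thom_mor u + F`_0) :: behead F), xi; split; last 2 first.
- by rewrite FE Fv.
- by rewrite FE Fw.
split=> //; first by move=> n x; rewrite -dF /= nth_behead.
by rewrite FE Fv; exact: (thom_morP (u + v)).
Qed.

Lemma thom_htpicZ a v w : thom_htpic v w -> thom_htpic (a *: v) (a *: w).
Proof.
have zL n : linear (fun f : gHom C O n => a *: f).
  by move=> b f g; rewrite scalerDr !scalerA mulrC.
move=> vw; apply: (thom_htpic_map (zL 0) (zL 1) _ _ _ vw) => // [s|f|s [cs ps]].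
- exact: (linearZZ (linear_fun (dhomh_linear (subrr 1))) a s).
- exact: is_thomZ.
- by rewrite -[_ *: _]addr0; apply: tangential_lin => //; apply: tangential0.
Qed.

Lemma thom_htpic_lie u v w : thom_htpic v w -> thom_htpic (lie u v) (lie u w).
Proof.
move=> vw; apply: (thom_htpic_map (bracket_linearr (addr0 0) (addr0 0) u)
  (bracket_linearr (add0r 1) (addr0 1) u) _ _ _ vw) => // [s|f tf|s ts].
- exact: (dhom_bracket u (subrr 1) (add0r 1) (addr0 1) (addr0 0) (addr0 0) s).
- exact: (thom_morP (thom_lie u (ThomMor tf))).
- by apply: tangential_bracket (thom_tangential u) ts; rewrite mul0r.
Qed.
End Fixed.

Section Precomposition.
Variables (C C' : ccdgCoalgebra k) (O : ccdgHopf k) (f : gHom C C' 0).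
Hypothesis fM : is_coalg_mor f.

Lemma thom_e_comph0 : comph0 (thom_e C' O) f = thom_e C O.
Proof. by have [_ ef _] := fM; apply: hom_ext => x /=; rewrite ef. Qed.

Lemma tangential_comph0 (n : int) (s : gHom C' O n) :
  tangential s -> tangential (comph0 s f).
Proof.
have [_ _ df] := fM => -[cs ps]; split=> x; first exact: cs.
rewrite -[comph0 s f x]/(s (f x)) ps df.
rewrite (tens_comph0 (thom_e C' O) s f f) (tens_comph0 s (thom_e C' O) f f).
by rewrite thom_e_comph0.
Qed.

Lemma is_thom_comph0 (v : gHom C' O 0) : is_thom v -> is_thom (comph0 v f).
Proof.
have [cf _ _] := fM; rewrite !is_thomE => -[cv tv].
by split=> [x|]; [rewrite dhom_comph0|exact: tangential_comph0].
Qed.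

Lemma conv_comph0 (p q n : int) (pq : p + q = n) (g : gHom C' O p) (h : gHom C' O q) :
  conv pq (comph0 g f) (comph0 h f) = comph0 (conv pq g h) f.
Proof.
have [_ _ df] := fM; apply: hom_ext => x.
rewrite convE -[RHS]/(conv pq g h (f x)) convE df.
by rewrite (tens_comph0 g h f f).
Qed.
End Precomposition.

Section Postcomposition.
Variables (C : ccdgCoalgebra k) (O O' : ccdgHopf k) (g : gHom O O' 0).
Hypothesis gM : is_hopf_mor g.

Lemma thom_e_comp0h : comp0h g (thom_e C O) = thom_e C O'.
Proof. by have [_ [ug _]] := gM; apply: hom_ext => x /=; rewrite ug. Qed.

Lemma tangential_comp0h (n : int) (s : gHom C O n) :
  tangential s -> tangential (comp0h g s).
Proof.
have [[_ eg dg] _] := gM => -[cs ps]; split=> x; first by rewrite /= eg cs.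
rewrite -[comp0h g s x]/(g (s x)) dg ps (linearD (g ⊗ g)).
rewrite (tens_comp0h g g (thom_e C O) s) (tens_comp0h g g s (thom_e C O)).
by rewrite thom_e_comp0h.
Qed.

Lemma is_thom_comp0h (v : gHom C O 0) : is_thom v -> is_thom (comp0h g v).
Proof.
have [[cg _ _] _] := gM; rewrite !is_thomE => -[cv tv].
split=> [x|]; last exact: tangential_comp0h.
by rewrite (dhom_comp0h _ _ cg) cv linear0.
Qed.

Lemma conv_comp0h (p q n : int) (pq : p + q = n) (h : gHom C O p) (h' : gHom C O q) :
  conv pq (comp0h g h) (comp0h g h') = comp0h g (conv pq h h').
Proof.
have [_ [_ mg]] := gM; apply: hom_ext => x.
rewrite convE -[RHS]/(g (conv pq h h' x)) convE mg.
by rewrite (tens_comp0h g g h h').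
Qed.
End Postcomposition.

End ThomHomotopy.

(** * Homotopies of coalgebra and Hopf morphisms acting on tangential maps, in characteristic 0 *)

Section PairHomotopy.
Variable k : fieldType.
Hypothesis k_char0 : [pchar k] =i pred0.

Lemma dhom0 (V W : complex k) (n : int) x : dhom (0 : gHom V W n) x = 0.
Proof.
rewrite -[LHS]/(cx_d W 0 - (-1 : k) ^ n *: (0 : W)).
by rewrite linear0 scaler0 subrr.
Qed.

Lemma natrS_neq0 (n : nat) : n.+1%:R != 0 :> k.
Proof. by have /pcharf0P-> := k_char0. Qed.

(** Characteristic 0 allows division by [n.+1]; the coefficients of positive degree thus inherit
    vanishing conditions from [xi]. *)
Lemma deriv_eqS (V W : complex k) (F : polyhom V W 0) (xi : polyhom V W 1) n x :
  deriv_eq F xi -> F`_n.+1 x = n.+1%:R^-1 *: dhom xi`_n x.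
Proof. by move=> <-; rewrite scalerA mulVf ?natrS_neq0 ?scale1r. Qed.

(** The coefficient of a product with a constant polynomial: only [i = 0] survives in the first
    family and only [i = n] in the second. It is applied to the composites of [F] with [thom_e]. *)
Lemma sum_tens_single (V W : graded k) (F : nat -> gHom V W 0)
    (S : nat -> gHom V W 1) (n : nat) c : (forall i, F i.+1 = 0) ->
  \sum_(i < n.+1) ((F i ⊗ S (n - i)%N) c + (S i ⊗ F (n - i)%N) c) =
  (F 0%N ⊗ S n) c + (S n ⊗ F 0%N) c.
Proof.
move=> F0; rewrite big_split big_ord_recl big_ord_recr /= subn0 subnn.
rewrite !big1 ?addr0 ?add0r // => i _; last by rewrite F0 tens0l.
have : (0 < n - i)%N by rewrite subn_gt0.
by case: (n - i)%N => // m _; rewrite F0 tens0r.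
Qed.

(** The counit is a chain map, so by [deriv_eqS] the left side is a multiple of the differential of
    [counit D] composed with a coefficient of [xi], which is 0. *)
Lemma coalg_pair_counit (C D : ccdgCoalgebra k) F xi n :
  @coalg_htpy_pair k C D F xi -> comp0h (counit D) F`_n.+1 = 0.
Proof.
move=> [dF _ cxi _]; apply: hom_ext => x.
rewrite -[LHS]/(counit D (F`_n.+1 x)) (deriv_eqS _ _ dF) linearZ /=.
rewrite -(dhom_comp0h _ _ (@counit_chain k D)).
have -> : comp0h (counit D) xi`_n = 0 by apply: hom_ext => y; apply: cxi.
by rewrite dhom0 scaler0.
Qed.

(** Dual to [coalg_pair_counit]: the unit is a chain map and [xi] vanishes on it. *)
Lemma hopf_pair_unit (O P : ccdgHopf k) F xi n :
  @hopf_htpy_pair k O P F xi -> comph0 F`_n.+1 (hunit O) = 0.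
Proof.
move=> [[dF _ _ _] _ uxi _]; apply: hom_ext => x.
rewrite -[LHS]/(F`_n.+1 (hunit O x)) (deriv_eqS _ _ dF).
rewrite -(dhom_comph0 _ _ (@hunit_chain k O)).
have -> : comph0 xi`_n (hunit O) = 0 by apply: hom_ext => y; apply: uxi.
by rewrite dhom0 scaler0.
Qed.

(** Composing [v] with the whole pair gives the homotopy. For its coproduct condition, [v] is
    primitive and [thom_e] kills [xi] and all but the constant coefficient of [F], so the
    convolution sum collapses. *)
Lemma thom_htpic_precomp (C C' : ccdgCoalgebra k) (O : ccdgHopf k)
    (f f' : coalgMor C C') (v : THom C' O) (w w' : THom C O) :
  coalg_htpic f f' -> thom_mor w = comph0 v f -> thom_mor w' = comph0 v f' ->
  thom_htpic w w'.
Proof.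
move=> [F [xi [pF Ff Ff']]] wE w'E; have [dF [_ eF _] cxi dxi] := pF.
exists (map (comp0h v) F), (map (comp0h v) xi).
split; last 2 first.
- by rewrite (peval_map (comp0h_linear v)) Ff wE comp0hE.
- by rewrite (peval_map (comp0h_linear v)) Ff' w'E comp0hE.
have nthE n := @polymap_nth k C C' C O n n _ (comp0h_linear v).
split=> [n x||n x|n x].
- rewrite !nthE (dhom_comp0h _ _ (thom_chain v)) -dF.
  exact: esym (linearZZ v _ _).
- rewrite (peval_map (comp0h_linear v)) Ff -comp0hE -wE; exact: thom_morP.
- by rewrite nthE; have [cv _] := thom_tangential v; apply: cv.
have [_ pv] := thom_tangential v.
rewrite nthE -[LHS]/(comul O (v (xi`_n x))) pv dxi.
rewrite !linear_sum -big_split /=.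
pose G i := comp0h (thom_e C' O) F`_i.
have G0 i : G i.+1 = 0.
  apply: hom_ext => y; rewrite -[LHS]/(hunit O (comp0h (counit C') F`_i.+1 y)).
  by rewrite (coalg_pair_counit _ pF) hom0E linear0.
have Ge : G 0%N = thom_e C O.
  (* The constant coefficient is the value at 0, a coalgebra morphism, hence compatible with
     counits. *)
  by apply: hom_ext => y; rewrite /= -peval0 eF.
have xi0 i : comp0h (thom_e C' O) xi`_i = 0.
  by apply: hom_ext => y; rewrite /= cxi linear0.
rewrite -Ge -(sum_tens_single (fun i => comp0h v xi`_i) n _ G0).
(* Each index yields four tensors; the two containing [thom_e] composed with [xi] vanish. *)
apply: eq_bigr => i _; rewrite !linearD.
rewrite (tens_comp0h (thom_e C' O) v F`_i xi`_(n - i)).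
rewrite (tens_comp0h (thom_e C' O) v xi`_i F`_(n - i)).
rewrite (tens_comp0h v (thom_e C' O) F`_i xi`_(n - i)).
rewrite (tens_comp0h v (thom_e C' O) xi`_i F`_(n - i)).
by rewrite !xi0 tens0l tens0r addr0 add0r.
Qed.

(** Mirror image of [thom_htpic_precomp]: here [F] and [xi] are applied after [thom_e], which
    factors through the unit of [O], so [hopf_pair_unit] collapses the sum. *)
Lemma thom_htpic_postcomp (C : ccdgCoalgebra k) (O O' : ccdgHopf k)
    (g g' : hopfMor O O') (v : THom C O) (w w' : THom C O') :
  hopf_htpic g g' -> thom_mor w = comp0h g v -> thom_mor w' = comp0h g' v ->
  thom_htpic w w'.
Proof.
move=> [F [xi [pF Fg Fg']]] wE w'E; have [[dF _ cxi dxi] [uF _] uxi _] := pF.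
have nthE n := @polymap_nth k O O' C O' n n _ (comph0_linear v).
exists (map ((@comph0 _ _ _ _ _)^~ v) F), (map ((@comph0 _ _ _ _ _)^~ v) xi).
split; last 2 first.
- by rewrite (peval_map (comph0_linear v)) Fg wE comp0hE.
- by rewrite (peval_map (comph0_linear v)) Fg' w'E comp0hE.
split=> [n x||n x|n x].
- by rewrite !nthE (dhom_comph0 _ _ (thom_chain v)) -dF.
- by rewrite (peval_map (comph0_linear v)) Fg comp0hE -wE; exact: thom_morP.
- by rewrite nthE; apply: cxi.
have [_ pv] := thom_tangential v.
rewrite nthE -[LHS]/(comul O' (xi`_n (v x))) dxi pv.
pose G i := comph0 F`_i (thom_e C O).
have G0 i : G i.+1 = 0.
  apply: hom_ext => y.
  by rewrite -[LHS]/(comph0 F`_i.+1 (hunit O) (counit C y)) (hopf_pair_unit _ pF).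
have Ge : G 0%N = thom_e C O'.
  by apply: hom_ext => y; rewrite /= -peval0 uF.
have xi0 i : comph0 xi`_i (thom_e C O) = 0.
  by apply: hom_ext => y; rewrite /= uxi.
rewrite -Ge -(sum_tens_single (fun i => comph0 xi`_i v) n _ G0).
apply: eq_bigr => i _; rewrite !linearD.
rewrite (tens_comph0 F`_i xi`_(n - i) (thom_e C O) v).
rewrite (tens_comph0 F`_i xi`_(n - i) v (thom_e C O)).
rewrite (tens_comph0 xi`_i F`_(n - i) (thom_e C O) v).
rewrite (tens_comph0 xi`_i F`_(n - i) v (thom_e C O)).
by rewrite !xi0 tens0l tens0r addr0 add0r.
Qed.
End PairHomotopy.

(** * Homotopy types *)

Lemma rclass_map (T T' : Type) (R : T -> T -> Prop) (R' : T' -> T' -> Prop)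
    (f : T -> T') : (forall x y, R x y -> R' (f x) (f y)) ->
  forall x y, rclass R x = rclass R y -> rclass R' (f x) = rclass R' (f y).
Proof.
move=> fR x y /rclassP xy; apply/rclassP.
elim: xy => [a b /fR|a|a b _|a b c _ ab _ bc].
- by constructor.
- exact: Relation_Operators.rst_refl.
- exact: Relation_Operators.rst_sym.
- exact: Relation_Operators.rst_trans ab bc.
Qed.

(** Polarization of [liexx] at [x + y]. *)
Lemma lieC (k : fieldType) (L : lieAlgType k) (x y : L) : lie x y = - lie y x.
Proof.
apply/eqP; rewrite -addr_eq0; apply/eqP.
have lDl a b c : lie (a + b) c = lie a c + lie b c :> L.
  by have := lie_linearl c 1 a b; rewrite !scale1r.
have lDr a b c : lie c (a + b) = lie c a + lie c b :> L.
  by have := lie_linearr c 1 a b; rewrite !scale1r.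
by have := liexx (x + y); rewrite lDl !lDr !liexx add0r addr0.
Qed.

(** * The Lie algebra of homotopy types of tangential morphisms *)

Section HomotopyLie.
Variables (k : fieldType) (C : ccdgCoalgebra k) (O : ccdgHopf k).
Local Notation T := (THomHo C O).
Local Notation cls := (@thtype_of k C O).

(** Operations on classes are defined on chosen representatives; [thtypeDE], [thtypeNE], [thtypeZE]
    and [thtype_lieE] give independence of the choice. *)
Definition thtype_repr (c : T) : THom C O := projT1 (cid (rclass_surj c)).
Lemma thtype_reprK c : cls (thtype_repr c) = c.
Proof. by rewrite /thtype_repr; case: cid. Qed.

(** Homotopies are moved through one argument at a time, the first being reached by
    commutativity. *)
Lemma eq_thtypeD v v' w w' :
  cls v = cls v' -> cls w = cls w' -> cls (v + w) = cls (v' + w').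
Proof.
move=> vv ww; transitivity (cls (v + w')).
  exact: (rclass_map (fun a b => @thom_htpicD k C O v a b) ww).
rewrite addrC [RHS](congr1 cls (addrC _ _)).
exact: (rclass_map (fun a b => @thom_htpicD k C O w' a b) vv).
Qed.

Lemma eq_thtypeZ a v v' : cls v = cls v' -> cls (a *: v) = cls (a *: v').
Proof. exact: (rclass_map (fun v w => @thom_htpicZ k C O a v w)). Qed.

(** As for sums, with antisymmetry and scaling by -1 in place of commutativity. *)
Lemma eq_thtype_lie v v' w w' :
  cls v = cls v' -> cls w = cls w' -> cls (lie v w) = cls (lie v' w').
Proof.
move=> vv ww; transitivity (cls (lie v w')).
  exact: (rclass_map (fun a b => @thom_htpic_lie k C O v a b) ww).
rewrite lieC [RHS](congr1 cls (lieC _ _)) -!scaleN1r; apply: eq_thtypeZ.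
exact: (rclass_map (fun a b => @thom_htpic_lie k C O w' a b) vv).
Qed.

Definition thtypeD (c d : T) : T := cls (thtype_repr c + thtype_repr d).
Definition thtypeN (c : T) : T := cls (- thtype_repr c).
Definition thtypeZ a (c : T) : T := cls (a *: thtype_repr c).
Definition thtype_lie (c d : T) : T := cls (lie (thtype_repr c) (thtype_repr d)).

Fact thtypeDE v w : thtypeD (cls v) (cls w) = cls (v + w).
Proof. by apply: eq_thtypeD; exact: thtype_reprK. Qed.
Fact thtypeNE v : thtypeN (cls v) = cls (- v).
Proof. by rewrite /thtypeN -!scaleN1r; apply: eq_thtypeZ; exact: thtype_reprK. Qed.
Fact thtypeZE a v : thtypeZ a (cls v) = cls (a *: v).
Proof. by apply: eq_thtypeZ; exact: thtype_reprK. Qed.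
Fact thtype_lieE v w : thtype_lie (cls v) (cls w) = cls (lie v w).
Proof. by apply: eq_thtype_lie; exact: thtype_reprK. Qed.

HB.instance Definition _ := gen_eqMixin T.
HB.instance Definition _ := gen_choiceMixin T.

Fact thtypeA : associative thtypeD.
Proof.
move=> c d e; rewrite -[c]thtype_reprK -[d]thtype_reprK -[e]thtype_reprK.
by rewrite !thtypeDE addrA.
Qed.
Fact thtypeC : commutative thtypeD.
Proof. by move=> c d; rewrite /thtypeD addrC. Qed.
Fact thtype0D : left_id (cls 0) thtypeD.
Proof. by move=> c; rewrite -[c]thtype_reprK thtypeDE add0r. Qed.
Fact thtypeND : left_inverse (cls 0) thtypeN thtypeD.
Proof. by move=> c; rewrite -[c]thtype_reprK thtypeNE thtypeDE addNr. Qed.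
HB.instance Definition _ := GRing.isZmodule.Build T thtypeA thtypeC thtype0D thtypeND.

Fact thtypeZA a b c : thtypeZ a (thtypeZ b c) = thtypeZ (a * b) c.
Proof. by rewrite -[c]thtype_reprK !thtypeZE scalerA. Qed.
Fact thtypeZ1 c : thtypeZ 1 c = c.
Proof. by rewrite -[c]thtype_reprK thtypeZE scale1r. Qed.
Fact thtypeZDr a : {morph thtypeZ a : c d / c + d}.
Proof.
move=> c d; rewrite -[LHS]/(thtypeZ a (thtypeD c d)).
rewrite -[RHS]/(thtypeD (thtypeZ a c) (thtypeZ a d)).
rewrite -[c]thtype_reprK -[d]thtype_reprK.
by rewrite thtypeDE !thtypeZE thtypeDE scalerDr.
Qed.
Fact thtypeZDl c : {morph thtypeZ ^~ c : a b / a + b}.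
Proof.
move=> a b; rewrite -[RHS]/(thtypeD (thtypeZ a c) (thtypeZ b c)).
by rewrite -[c]thtype_reprK !thtypeZE thtypeDE scalerDl.
Qed.
HB.instance Definition _ :=
  GRing.Zmodule_isLmodule.Build k T thtypeZA thtypeZ1 thtypeZDr thtypeZDl.

Lemma thtype_of_linear : linear cls.
Proof.
move=> a v w.
by rewrite -[RHS]/(thtypeD (thtypeZ a (cls v)) (cls w)) thtypeZE thtypeDE.
Qed.

Fact thtype_lie_linearl d : linear (thtype_lie^~ d).
Proof.
move=> a b c; rewrite -[b]thtype_reprK -[c]thtype_reprK -[d]thtype_reprK.
by rewrite -thtype_of_linear !thtype_lieE lie_linearl thtype_of_linear.
Qed.
Fact thtype_lie_linearr d : linear (thtype_lie d).
Proof.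
move=> a b c; rewrite -[b]thtype_reprK -[c]thtype_reprK -[d]thtype_reprK.
by rewrite -thtype_of_linear !thtype_lieE lie_linearr thtype_of_linear.
Qed.
Fact thtype_liexx c : thtype_lie c c = 0.
Proof. by rewrite -[c]thtype_reprK thtype_lieE liexx. Qed.
Fact thtype_jacobi b c d :
  thtype_lie b (thtype_lie c d) + thtype_lie c (thtype_lie d b) +
  thtype_lie d (thtype_lie b c) = 0.
Proof.
rewrite -[b]thtype_reprK -[c]thtype_reprK -[d]thtype_reprK.
rewrite !thtype_lieE -[LHS]/(thtypeD (thtypeD _ _) _) !thtypeDE.
by rewrite lie_jacobi.
Qed.
HB.instance Definition _ := Lmodule_isLie.Build k T
  thtype_lie_linearl thtype_lie_linearr thtype_liexx thtype_jacobi.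
End HomotopyLie.

(** * Homotopy equivalences as isomorphisms of the homotopy category *)

Section Isomorphisms.

Lemma functor_iso (A B : category) (F : A -> B) (TF : functor F) (x y : A)
    (f : Mor x y) : is_iso f -> is_iso (TF _ _ f).
Proof.
by move=> [g [gf fg]]; exists (TF _ _ g); rewrite -!fmapM gf fg !fmap1.
Qed.

Lemma op_iso (A : category) (x y : A) (f : Mor x y) :
  is_iso f -> @is_iso (op A) y x f.
Proof. by move=> [g [gf fg]]; exists g. Qed.

Lemma htpy_equiv_iso (A : htpy_category) (x y : A) (f : Mor x y) :
  htpy_equiv f -> @is_iso (ho A) x y (htype_of f).
Proof.
by move=> [g [gf fg]]; exists (htype_of g); split;
  rewrite [LHS]htype_compE; apply: rclass_rel.
Qed.
End Isomorphisms.

(** * The presheaf of Lie algebras attached to a Hopf algebra *)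

Section Pullback.
Variable k : fieldType.
Variable O : ccdgHopf k.

Definition thom_pull (C C' : ccdgCoalgebra k) (f : coalgMor C C') (v : THom C' O) :
    THom C O :=
  ThomMor (is_thom_comph0 (coalg_morP f) (thom_morP v)).

Definition ho_pull_fun (C C' : ccdgC k) (p : htype C C') (c : THomHo C' O) :
    THomHo C O :=
  thtype_of (thom_pull (htype_repr p) (thtype_repr c)).

Lemma eq_thom_pullr (C C' : ccdgCoalgebra k) (f : coalgMor C C') (v v' : THom C' O) :
  thtype_of v = thtype_of v' ->
  thtype_of (thom_pull f v) = thtype_of (thom_pull f v').
Proof.
apply: rclass_map => {}v {}v' vv.
apply: (thom_htpic_map (comph0_linear f) (comph0_linear f) _ _ _ vv) => // [s|w|s].
- apply: hom_ext => x; have [cf _ _] := coalg_morP f.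
  exact: dhom_comph0.
- by move=> tw; apply: is_thom_comph0 tw; exact: coalg_morP.
- by move=> ts; apply: tangential_comph0 ts; exact: coalg_morP.
Qed.

Lemma ho_pull_reprE (C C' : ccdgC k) (p : htype C C') v :
  ho_pull_fun p (thtype_of v) = thtype_of (thom_pull (htype_repr p) v).
Proof. by apply: eq_thom_pullr; rewrite thtype_reprK. Qed.

Fact ho_pull_linear (C C' : ccdgC k) (p : htype C C') : linear (ho_pull_fun p).
Proof.
move=> a c d; rewrite -[c]thtype_reprK -[d]thtype_reprK.
rewrite -thtype_of_linear !ho_pull_reprE -thtype_of_linear.
by congr thtype_of; apply: thom_ext; apply: hom_ext.
Qed.

Fact ho_pull_lie (C C' : ccdgC k) (p : htype C C') (c d : THomHo C' O) :
  to_linear (ho_pull_linear p) (lie c d) =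
  lie (to_linear (ho_pull_linear p) c) (to_linear (ho_pull_linear p) d).
Proof.
rewrite !to_linearE -[c]thtype_reprK -[d]thtype_reprK.
rewrite -[lie (thtype_of _) _]/(thtype_lie _ _) thtype_lieE !ho_pull_reprE.
rewrite -[RHS]/(thtype_lie _ _) thtype_lieE; congr thtype_of; apply: thom_ext.
by rewrite /= /bracket !(conv_comph0 (coalg_morP (htype_repr p))); apply: hom_ext.
Qed.

Definition ho_pull (C C' : ccdgC k) (p : htype C C') :
    lieMor (THomHo C' O) (THomHo C O) :=
  LieMor (ho_pull_lie p).

Hypothesis k_char0 : [pchar k] =i pred0.

(** First [v] is replaced with [f] fixed, where pulling back is linear; then [f] is replaced by
    [thom_htpic_precomp], one elementary homotopy at a time. *)
Lemma eq_thom_pull (C C' : ccdgC k) (f f' : Mor C C') (v v' : THom C' O) :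
  htype_of f = htype_of f' -> thtype_of v = thtype_of v' ->
  thtype_of (thom_pull f v) = thtype_of (thom_pull f' v').
Proof.
move=> ff /(eq_thom_pullr f) ->.
have pullH (g g' : coalgMor C C') :
    coalg_htpic g g' -> thom_htpic (thom_pull g v') (thom_pull g' v').
  by move=> gg; exact: (thom_htpic_precomp k_char0 gg).
exact: (rclass_map pullH ff).
Qed.

Lemma ho_pullE (C C' : ccdgC k) (f : Mor C C') (v : THom C' O) :
  ho_pull (htype_of f) (thtype_of v) = thtype_of (thom_pull f v).
Proof.
rewrite [LHS]to_linearE; apply: eq_thom_pull; first exact: htype_reprK.
exact: thtype_reprK.
Qed.

Fact ho_pull1 (C : ccdgC k) :
  ho_pull (htype_of (idm C)) = lie_id (THomHo C O).
Proof.
apply: lieMor_ext => c; rewrite -[c]thtype_reprK ho_pullE.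
by congr thtype_of; apply: thom_ext; apply: hom_ext.
Qed.

Fact ho_pullM (C C' C'' : ccdgC k) (q : htype C' C'') (p : htype C C') :
  ho_pull (htype_comp q p) = lie_cmp (ho_pull p) (ho_pull q).
Proof.
apply: lieMor_ext => c; rewrite -[c]thtype_reprK -[q]htype_reprK -[p]htype_reprK.
rewrite htype_compE ho_pullE -[RHS]/(ho_pull _ (ho_pull _ _)) !ho_pullE.
by congr thtype_of; apply: thom_ext; apply: hom_ext.
Qed.

Definition thom_presheaf :
    @functor (op (ho (ccdgC k))) (Lie k) (fun C => THomHo C O : lieAlgType k) :=
  @Functor (op (ho (ccdgC k))) (Lie k) (fun C => THomHo C O : lieAlgType k)
    (fun C C' p => ho_pull p) ho_pull1 (fun C C' C'' q p => ho_pullM p q).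
End Pullback.

(** * Covariance in the Hopf algebra *)

Section Pushforward.
Variables (k : fieldType) (C : ccdgCoalgebra k).

Definition thom_push (O O' : ccdgHopf k) (g : hopfMor O O') (v : THom C O) :
    THom C O' :=
  ThomMor (is_thom_comp0h (hopf_morP g) (thom_morP v)).

Definition ho_push_fun (O O' : ccdgH k) (p : htype O O') (c : THomHo C O) :
    THomHo C O' :=
  thtype_of (thom_push (htype_repr p) (thtype_repr c)).

Lemma eq_thom_pushr (O O' : ccdgHopf k) (g : hopfMor O O') (v v' : THom C O) :
  thtype_of v = thtype_of v' ->
  thtype_of (thom_push g v) = thtype_of (thom_push g v').
Proof.
apply: rclass_map => {}v {}v' vv; have gM := hopf_morP g.
apply: (thom_htpic_map (comp0h_linear g) (comp0h_linear g) _ _ _ vv) => // [s|w|s].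
- apply: hom_ext => x; have [[cg _ _] _] := gM; exact: dhom_comp0h.
- by move=> tw; apply: is_thom_comp0h tw.
- by move=> ts; apply: tangential_comp0h ts.
Qed.

Lemma ho_push_reprE (O O' : ccdgH k) (p : htype O O') v :
  ho_push_fun p (thtype_of v) = thtype_of (thom_push (htype_repr p) v).
Proof. by apply: eq_thom_pushr; rewrite thtype_reprK. Qed.

Fact ho_push_linear (O O' : ccdgH k) (p : htype O O') : linear (ho_push_fun p).
Proof.
move=> a c d; rewrite -[c]thtype_reprK -[d]thtype_reprK.
rewrite -thtype_of_linear !ho_push_reprE -thtype_of_linear.
by congr thtype_of; apply: thom_ext; exact: comp0h_linear.
Qed.

Fact ho_push_lie (O O' : ccdgH k) (p : htype O O') (c d : THomHo C O) :
  to_linear (ho_push_linear p) (lie c d) =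
  lie (to_linear (ho_push_linear p) c) (to_linear (ho_push_linear p) d).
Proof.
rewrite !to_linearE -[c]thtype_reprK -[d]thtype_reprK.
rewrite -[lie (thtype_of _) _]/(thtype_lie _ _) thtype_lieE !ho_push_reprE.
rewrite -[RHS]/(thtype_lie _ _) thtype_lieE; congr thtype_of; apply: thom_ext.
rewrite /= /bracket !(conv_comp0h (hopf_morP (htype_repr p))).
exact: (linearB (linear_fun (comp0h_linear (htype_repr p : hopfMor O O')))).
Qed.

Definition ho_push (O O' : ccdgH k) (p : htype O O') :
    lieMor (THomHo C O) (THomHo C O') :=
  LieMor (ho_push_lie p).

Hypothesis k_char0 : [pchar k] =i pred0.

Lemma eq_thom_push (O O' : ccdgH k) (g g' : Mor O O') (v v' : THom C O) :
  htype_of g = htype_of g' -> thtype_of v = thtype_of v' ->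
  thtype_of (thom_push g v) = thtype_of (thom_push g' v').
Proof.
move=> gg /(eq_thom_pushr g) ->.
have pushH (f f' : hopfMor O O') :
    hopf_htpic f f' -> thom_htpic (thom_push f v') (thom_push f' v').
  by move=> ff; exact: (thom_htpic_postcomp k_char0 ff).
exact: (rclass_map pushH gg).
Qed.

Lemma ho_pushE (O O' : ccdgH k) (g : Mor O O') (v : THom C O) :
  ho_push (htype_of g) (thtype_of v) = thtype_of (thom_push g v).
Proof.
rewrite [LHS]to_linearE; apply: eq_thom_push; first exact: htype_reprK.
exact: thtype_reprK.
Qed.

Fact ho_push1 (O : ccdgH k) : ho_push (htype_of (idm O)) = lie_id (THomHo C O).
Proof.
apply: lieMor_ext => c; rewrite -[c]thtype_reprK ho_pushE.
by congr thtype_of; apply: thom_ext; apply: hom_ext.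
Qed.

Fact ho_pushM (O O' O'' : ccdgH k) (q : htype O' O'') (p : htype O O') :
  ho_push (htype_comp q p) = lie_cmp (ho_push q) (ho_push p).
Proof.
apply: lieMor_ext => c; rewrite -[c]thtype_reprK -[q]htype_reprK -[p]htype_reprK.
rewrite htype_compE ho_pushE -[RHS]/(ho_push _ (ho_push _ _)) !ho_pushE.
by congr thtype_of; apply: thom_ext; apply: hom_ext.
Qed.

(** For fixed [C] the construction is a functor of the Hopf algebra; it turns homotopy equivalences
    of Hopf algebras into isomorphisms at each [C]. *)
Definition thom_functor :
    @functor (ho (ccdgH k)) (Lie k) (fun O => THomHo C O : lieAlgType k) :=
  @Functor (ho (ccdgH k)) (Lie k) (fun O => THomHo C O : lieAlgType k)
    (fun O O' p => ho_push p) ho_push1 ho_pushM.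
End Pushforward.

(** * The natural transformation induced by a homotopy type of Hopf morphisms *)

Section Naturality.
Variables (k : fieldType) (k_char0 : [pchar k] =i pred0).
Variables (O O' : ccdgH k) (p : htype O O').

(** On representatives this is associativity of composition of linear maps. *)
Fact ho_push_natural (C' C : ccdgC k) (q : htype C C') :
  lie_cmp (ho_push C p) (ho_pull O q) = lie_cmp (ho_pull O' q) (ho_push C' p).
Proof.
apply: lieMor_ext => c; rewrite -[c]thtype_reprK -[q]htype_reprK -[p]htype_reprK.
rewrite -[LHS]/(ho_push _ _ (ho_pull _ _ _)) -[RHS]/(ho_pull _ _ (ho_push _ _ _)).
rewrite (ho_pullE k_char0) !(ho_pushE k_char0) (ho_pullE k_char0).
by congr thtype_of; apply: thom_ext; apply: hom_ext.
Qed.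

Definition thom_nattrans :
    nattrans (thom_presheaf O k_char0) (thom_presheaf O' k_char0) :=
  @Nattrans (op (ho (ccdgC k))) (Lie k) _ _ (thom_presheaf O k_char0)
    (thom_presheaf O' k_char0) (fun C => ho_push C p) ho_push_natural.
End Naturality.

Theorem theorem3p2 (k : fieldType) (k_char0 : [pchar k] =i pred0) :
  exists (L : forall (O : ccdgH k) (C : ccdgC k), lie_structure k (THomHo C O))
         (TP : forall O : ccdgH k,
            @functor (op (ho (ccdgC k))) (Lie k) (fun C => lie_alg (L O C))),
  (forall O : ccdgH k,
    (forall (C : ccdgC k) (a : k) (v1 v2 : THom C O),
      let c1 : lie_alg (L O C) := thtype_of v1 in
      let c2 : lie_alg (L O C) := thtype_of v2 in
      [/\ has_thtype (c1 + c2) (fun x => v1 x + v2 x),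
          has_thtype (a *: c1) (fun x => a *: v1 x) &
          has_thtype (lie c1 c2)
            (fun x => hmul O ((v1 ⊗ v2) (comul C x) - (v2 ⊗ v1) (comul C x)))]) /\
    (forall (C C' : ccdgC k) (f : Mor C C') (v' : THom C' O),
      has_thtype ((fmap (TP O) (htype_of f) : lieMor _ _) (thtype_of v'))
        (fun x => v' (f x))) /\
    (forall (C C' : ccdgC k) (f : Mor C C'), htpy_equiv f ->
      is_iso (fmap (TP O) (htype_of f)))) /\
  (forall (O O' : ccdgH k) (p : @Mor (ho (ccdgH k)) O O'),
    exists N : nattrans (TP O) (TP O'),
      (forall (C : ccdgC k) (psi : Mor O O') (v : THom C O), htype_of psi = p ->
        has_thtype ((ncomp N C : lieMor _ _) (thtype_of v))
          (fun x => psi (v x))) /\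
      (forall psi : Mor O O', htype_of psi = p -> htpy_equiv psi ->
        is_natiso N)).
Proof.
exists (fun O C => LieAlgebra.class (THomHo C O)).
exists (fun O => thom_presheaf O k_char0); split=> [O|O O' p].
  split=> [C a v1 v2 c1 c2|].
    split; [exists (v1 + v2)|exists (a *: v1)|exists (lie v1 v2)] => //.
    - by rewrite -[LHS]/(thtypeD _ _) thtypeDE.
    - by rewrite -[LHS]/(thtypeZ _ _) thtypeZE.
    - by move=> x; rewrite linearB.
    - by rewrite -[LHS]/(thtype_lie _ _) thtype_lieE.
  split=> [C C' f v'|C C' f fE].
    by exists (thom_pull f v') => //; exact: ho_pullE.
  by apply: (functor_iso (thom_presheaf O k_char0)); exact/op_iso/htpy_equiv_iso.
exists (thom_nattrans k_char0 p); split=> [C psi v <-|psi <- psiE C].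
  by exists (thom_push psi v) => //; exact: ho_pushE.
(* The component at [C] is the value of the covariant functor [thom_functor] on the class of [psi],
   which is invertible in the homotopy category. *)
exact: (functor_iso (thom_functor C k_char0)) (htpy_equiv_iso psiE).
Qed.
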